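(* Work in Case A ($t,t_N$ algebraically independent) with sign $\epsilon=-$. For all $\alpha\le\beta$ in $\mathcal P_N=\{1,2\}^N$, $$\mathbf t^{|\alpha|-|\beta|}Q^{A,II,-}_{\alpha,\beta}=\mathbf t^{|\alpha|-|\beta|}P^{A,-}_{\alpha,\beta},$$ and for $\alpha\in F^A(\beta)$ this common value is $$t^{-d^A(\alpha,\beta)}\,t_N^{-d^A_o(\alpha,\beta)}\,(t/t_N)^{-d^A_e(\alpha,\beta)}.$$
   Context: Order and length: $\alpha\le\beta$ (Bruhat order) iff every prefix of $\alpha$ contains at least as many $1$'s as the prefix of $\beta$ of the same length. If $p_1<\dots<p_r$ are the positions of the $2$'s in $\alpha$, put $\mathbf t^{|\alpha|}=t^{\sum_k(N-p_k)}t_N^{\,r}$ and $\mathbf t^{|\alpha|-|\beta|}=\mathbf t^{|\alpha|}/\mathbf t^{|\beta|}$. Flips. In $\beta$, repeatedly pair an adjacent $2$ and $1$ (in this order) and remove them, until a string $1\cdots12\cdots2$ remains; the remaining letters are unpaired. The $(2i-1)$-th (resp. $2i$-th) unpaired $2$ from the right is o-unpaired (resp. e-unpaired). $F^A(\beta)$ is the set of strings $\alpha$ obtained from $\beta$ by flipping some (possibly no) pairs and unpaired $2$'s, where flipping a pair exchanges its $2$ and $1$, and flipping an unpaired $2$ changes it to $1$. For $\alpha\in F^A(\beta)$, $d^A(\alpha,\beta)$, $d^A_e(\alpha,\beta)$, $d^A_o(\alpha,\beta)$ are the numbers of flipped pairs, flipped e-unpaired $2$'s and flipped o-unpaired $2$'s.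 Kazhdan–Lusztig polynomials. The Iwahori–Hecke algebra $\mathcal H$ of type $B_N$ over $\mathbb C[t^{\pm1},t_N^{\pm1}]$ has generators $T_1,\dots,T_N$, the type $B_N$ braid relations (bond of order 4 between $N-1$ and $N$), $(T_i-t)(T_i+t^{-1})=0$ for $i<N$ and $(T_N-t_N)(T_N+t_N^{-1})=0$. Bar involution: $T_i\mapsto T_i^{-1}$, $t\mapsto t^{-1}$, $t_N\mapsto t_N^{-1}$. The module $\mathcal M^-$ has basis $\{m_\alpha:\alpha\in\mathcal P_N\}$ with, for $i<N$: $T_im_\alpha=-t^{-1}m_\alpha$ if $\alpha_i=\alpha_{i+1}$; $m_{s_i\cdot\alpha}$ if $\alpha_i<\alpha_{i+1}$; $m_{s_i\cdot\alpha}+(t-t^{-1})m_\alpha$ if $\alpha_i>\alpha_{i+1}$; and $T_Nm_\alpha=m_{s_N\cdot\alpha}$ if $\alpha_N=1$, $m_{s_N\cdot\alpha}+(t_N-t_N^{-1})m_\alpha$ if $\alpha_N=2$ ($s_i$ exchanges $\alpha_i,\alpha_{i+1}$; $s_N$ replaces $\alpha_N$ by $3-\alpha_N$). The bar involution on $\mathcal M^-$ is semilinear with $\overline{m_{1\ldots1}}=m_{1\ldots1}$, $\overline{hv}=\bar h\bar v$. Let $\Gamma_+^A=\{t^it_N^j: i>0,j\in\mathbb Z\}\cup\{t_N^i:i>0\}$, $\Gamma^A_-=\{g^{-1}:g\in\Gamma^A_+\}$. There is a unique bar-invariant basis $C^{A,-}_\beta=\sum_{\alpha\le\beta}\mathbf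 t^{|\alpha|-|\beta|}P^{A,-}_{\alpha,\beta}m_\alpha$ with $P^{A,-}_{\beta,\beta}=1$ and $\mathbf t^{|\alpha|-|\beta|}P^{A,-}_{\alpha,\beta}$ in the $\mathbb Z$-span of $\Gamma^A_-$ for $\alpha<\beta$. Generating function $Q^{A,II,-}$. A string $\alpha$ is identified with the lattice path from $(0,0)$ whose $i$-th step is $(1,-1)$ if $\alpha_i=1$ and $(1,1)$ if $\alpha_i=2$; $\alpha\le\beta$ iff path $\alpha$ is weakly below path $\beta$. A box $(i,j)$ is the 45-degree rotated square centred at $(i,j)$ with vertices $(i\pm1,j),(i,j\pm1)$. $\lambda^-(\alpha)$ is the set of boxes $(i,j)$ with $0<i\le N$, $|j|\le i$, $i+j-1$ even, below the path $\alpha$. The region for $\alpha\le\beta$ is $\lambda^-(\beta)/\lambda^-(\alpha)$; its boxes $(N,j)$ are anchor boxes. For a box $(x,y)$: NE is $(x+1,y+1)$, NW is $(x-1,y+1)$, just above is $(x,y+2)$. A ballot path of length $(l,l')\in\mathbb N^2$ is a path with steps $(1,\pm1)$ from some $(x,y)$ to $(x+2l+l',y+l')$ staying weakly above height $y$; a ballot strip of length $(l,l')$ is the set of boxes centred at its vertices. $\mathrm{Conf}^{II}(\alpha,\beta)$ is the set of partitions of the boxes of the region into ballot strips such that: (Rule 0) the rightmost box of a strip with $l'\ge1$ is an anchor box; (Rule IIa) for strips $\mathcal D,\mathcal D'$, if some box of $\mathcal D'$ is just above, NW or NE of a box of $\mathcal D$, then all boxes just above, NW and NE of a box of $\mathcal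 D$ belong to $\mathcal D$ or $\mathcal D'$ (positions with first coordinate $>N$ are disregarded). The weight of a strip of length $(l,l')$ is $t^{2l+l'}$ if $l'$ is even and $t^{2l+l'-1}t_N^2$ if $l'$ is odd. $Q^{A,II,-}_{\alpha,\beta}$ is the sum over $\mathrm{Conf}^{II}(\alpha,\beta)$ of the product of the weights of the strips. *)

(* Defs.v *)
From HB Require Import structures.
From mathcomp Require Import all_boot all_order all_algebra all_fingroup.
From mathcomp Require Import reals complex.

Set Implicit Arguments.
Unset Strict Implicit.
Unset Printing Implicit Defensive.

Import Order.TTheory GRing.Theory Num.Theory.
Local Open Scope ring_scope.

(* A string in {1,2}^N: the letter 2 is [true], the letter 1 is [false].
   Positions are 0-based: [i : 'I_N] is the position i + 1 of the text. *)
Notation word N := {ffun 'I_N -> bool}.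

Section Words.
Variable N : nat.
Implicit Types (a b : word N) (i j : 'I_N).

Definition all1 : word N := [ffun=> false].

Definition ones a (n : nat) : nat := #|[set i : 'I_N | (i < n)%N & ~~ a i]|.

Definition leB a b : bool :=
  [forall n : 'I_N.+1, (ones b n <= ones a n)%N].

Definition swap_letters i j a : word N := [ffun k => a (tperm i j k)].

Definition flip_letter i a : word N :=
  [ffun k => if k == i then ~~ a k else a k].

End Words.

Section Flips.
Variable N : nat.
Implicit Types (a b : word N) (s : seq 'I_N).

(* Positions not removed yet are kept in increasing order in [s].  One step
   pairs and removes the leftmost adjacent 2,1; the order of the removals does
   not affect the result. *)
Fixpoint remove21 b s : option (('I_N * 'I_N) * seq 'I_N) :=
  match s with
  | i :: s1 =>
    if s1 is j :: s2 then
      if b i && ~~ b j then Some ((i, j), s2)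
      else omap (fun r => (r.1, i :: r.2)) (remove21 b s1)
    else None
  | [::] => None
  end.

Fixpoint pairing_rec (fuel : nat) b s : seq ('I_N * 'I_N) * seq 'I_N :=
  if fuel is n.+1 then
    if remove21 b s is Some (p, s') then
      let: (ps, r) := pairing_rec n b s' in (p :: ps, r)
    else ([::], s)
  else ([::], s).

(* N steps are enough, as each step removes two of the N positions. *)
Definition pairing b := pairing_rec N b (enum 'I_N).

Definition pairs b : {set 'I_N * 'I_N} := [set p in (pairing b).1].

Definition unpaired2_seq b : seq 'I_N := [seq i <- (pairing b).2 | b i].

Definition unpaired2 b : {set 'I_N} := [set i in unpaired2_seq b].

(* 0-based rank from the right among the unpaired 2's, so that the
   o-unpaired (first, third, ...) ones have even rank. *)
Definition rank_from_right b i : nat := index i (rev (unpaired2_seq b)).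

Definition o_unpaired b : {set 'I_N} :=
  [set i in unpaired2 b | ~~ odd (rank_from_right b i)].
Definition e_unpaired b : {set 'I_N} :=
  [set i in unpaired2 b | odd (rank_from_right b i)].

(* Exchanging the 2 and the 1 of a pair negates both of its letters. *)
Definition flip b (A : {set 'I_N * 'I_N}) (B : {set 'I_N}) : word N :=
  [ffun i => if [exists p in A, (i == p.1) || (i == p.2)] then ~~ b i
             else if i \in B then false else b i].

Definition FA b : {set word N} :=
  [set flip b A B | A in powerset (pairs b), B in powerset (unpaired2 b)].

Definition dA a b : nat := #|[set p in pairs b | a p.1 != b p.1]|.
Definition dAo a b : nat := #|[set i in o_unpaired b | a i != b i]|.
Definition dAe a b : nat := #|[set i in e_unpaired b | a i != b i]|.

End Flips.

(* [L] is the algebra C[t^{+-1}, tN^{+-1}] with t and tN algebraically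
   independent: the monomials t^i tN^j form a C-basis of L. *)
Definition is_laurent (C : fieldType) (L : comUnitAlgType C) (t tN : L) : Prop :=
  let mono (k : int * int) := t ^ k.1 * tN ^ k.2 in
  [/\ t \is a GRing.unit, tN \is a GRing.unit,
      forall x : L, exists s : seq (int * int), exists c : int * int -> C,
        x = \sum_(k <- s) c k *: mono k
    & forall (s : seq (int * int)) (c : int * int -> C), uniq s ->
        \sum_(k <- s) c k *: mono k = 0 -> {in s, forall k, c k = 0}].

Section Hecke.
Variables (L : comUnitRingType) (t tN : L) (N : nat).

Definition heckeB_relations (A : algType L) (T : 'I_N -> A) : Prop :=
  [/\ forall i j : 'I_N, j = i.+1 :> nat -> (j.+1 < N)%N ->
        T i * T j * T i = T j * T i * T j,
      forall i j : 'I_N, j = i.+1 :> nat -> j.+1 = N ->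
        T i * T j * T i * T j = T j * T i * T j * T i,
      forall i j : 'I_N, (i.+1 < j)%N -> T i * T j = T j * T i,
      forall i : 'I_N, (i.+1 < N)%N -> (T i - t%:A) * (T i + t^-1%:A) = 0
    & forall i : 'I_N, i.+1 = N -> (T i - tN%:A) * (T i + tN^-1%:A) = 0].

(* (H, T) is the algebra presented by the generators T_i and these relations. *)
Definition is_heckeB (H : algType L) (T : 'I_N -> H) : Prop :=
  heckeB_relations T /\
  forall (A : algType L) (S : 'I_N -> A), heckeB_relations S ->
    exists2 f : {lrmorphism H -> A}, forall i, f (T i) = S i
      & forall g : {lrmorphism H -> A}, (forall i, g (T i) = S i) -> g =1 f.

(* L acts on an H-module through c |-> c%:A. *)
Definition is_basis (H : algType L) (M : lmodType H) (m : word N -> M) : Prop :=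
  forall v : M, exists! c : {ffun word N -> L}, v = \sum_a (c a)%:A *: m a.

Definition is_Mminus (H : algType L) (T : 'I_N -> H) (M : lmodType H)
    (m : word N -> M) : Prop :=
  [/\ is_basis m,
      forall (i j : 'I_N) (a : word N), j = i.+1 :> nat ->
        T i *: m a =
          if a i == a j then (- t^-1)%:A *: m a
          else if a j then m (swap_letters i j a)
          else m (swap_letters i j a) + (t - t^-1)%:A *: m a
    & forall (i : 'I_N) (a : word N), i.+1 = N ->
        T i *: m a =
          if a i then m (flip_letter i a) + (tN - tN^-1)%:A *: m a
          else m (flip_letter i a)].

Definition tpow (a : word N) : L :=
  t ^+ (\sum_(k < N | a k) (N - k.+1)) * tN ^+ #|[set k | a k]|.

(* This is t^{|a|-|b|}. *)
Definition tdiff (a b : word N) : L := tpow a / tpow b.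

Definition GammaA_pos (x : L) : Prop :=
  (exists i j : int, 0 < i /\ x = t ^ i * tN ^ j) \/
  (exists i : int, 0 < i /\ x = tN ^ i).

Definition GammaA_neg (x : L) : Prop := exists2 g, GammaA_pos g & x = g^-1.

Definition in_Zspan (S : L -> Prop) (x : L) : Prop :=
  exists (s : seq L) (c : L -> int),
    {in s, forall g, S g} /\ x = \sum_(g <- s) g *~ c g.

Definition is_KL (H : algType L) (M : lmodType H) (m : word N -> M)
    (barM : M -> M) (C : word N -> M) (P : word N -> word N -> L) : Prop :=
  [/\ is_basis C,
      forall b, barM (C b) = C b,
      forall b, C b = \sum_(a | leB a b) (tdiff a b * P a b)%:A *: m a,
      forall b, P b b = 1
    & forall a b, leB a b -> a != b ->
        in_Zspan GammaA_neg (tdiff a b * P a b)].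

Definition height (a : word N) (i : nat) : int :=
  \sum_(k < N | (k < i)%N) (if a k then 1 else -1).

(* The pair (u, v) stands for the box centred at (u + 1, v - N): this covers
   all centres (i, j) with 0 < i <= N and |j| <= N. *)
Notation box := ('I_N * 'I_(N.*2.+1))%type.
Implicit Types (b : box) (D : {set box}) (Pi : {set {set box}}).

Definition pos b : int * int := (b.1.+1%:Z, b.2%:Z - N%:Z).

(* The box (i, j) is below the path when its top vertex (i, j + 1) is weakly
   below the path. *)
Definition lambda_minus (a : word N) : {set box} :=
  [set b | [&& `|(pos b).2| <= (pos b).1,
               (2 %| (pos b).1 + (pos b).2 - 1)%Z
             & (pos b).2 + 1 <= height a b.1.+1]].

Definition region (al be : word N) : {set box} :=
  lambda_minus be :\: lambda_minus al.

Definition anchor b : bool := (pos b).1 == N%:Z.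

Definition neighbours (p : int * int) : seq (int * int) :=
  [:: (p.1, p.2 + 2); (p.1 - 1, p.2 + 1); (p.1 + 1, p.2 + 1)].

Definition path_step (p q : int * int) : bool :=
  (q.1 == p.1 + 1) && ((q.2 == p.2 + 1) || (q.2 == p.2 - 1)).

Definition ballot_path (l l' : nat) (s : seq (int * int)) : bool :=
  if s is p :: s' then
    [&& path path_step p s', all (fun q => p.2 <= q.2) s'
      & last p s' == (p.1 + (l.*2 + l')%:Z, p.2 + l'%:Z)]
  else false.

Definition ballot_strip (l l' : nat) D : bool :=
  [exists s : (l.*2 + l').+1.-tuple box,
     ballot_path l l' (map pos s) && (D == [set b in s])].

(* The length (l, l') of a strip is unique, and 2 l + l' < N because the
   first coordinate increases along the path. *)
Definition strip_length D : option ('I_N * 'I_N) :=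
  [pick l : 'I_N * 'I_N | ballot_strip l.1 l.2 D].

Definition rule0 Pi : bool :=
  [forall D in Pi, forall l : 'I_N * 'I_N,
     ballot_strip l.1 l.2 D && (0 < l.2)%N ==>
     [forall b in D,
        [forall b' in D, (pos b').1 <= (pos b).1] ==> anchor b]].

(* Positions outside the region do count among the neighbours: a strip whose
   neighbour with first coordinate at most N is not in the region violates the
   conclusion.  The two strips are distinct. *)
Definition ruleIIa Pi : bool :=
  [forall D in Pi, forall D' in Pi,
     (D != D') &&
     [exists b in D, exists b' in D', pos b' \in neighbours (pos b)] ==>
     [forall b in D, all (fun p => (p.1 <= N%:Z) ==>
                                   [exists b' in D :|: D', pos b' == p])
                         (neighbours (pos b))]].

Definition ConfII (al be : word N) : {set {set {set box}}} :=
  [set Pi | [&& partition Pi (region al be),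
                [forall D in Pi, strip_length D : bool],
                rule0 Pi & ruleIIa Pi]].

Definition strip_weight D : L :=
  if strip_length D is Some (l, l') then
    if odd l' then t ^+ (l.*2 + l' - 1) * tN ^+ 2 else t ^+ (l.*2 + l')
  else 0.

Definition QII (al be : word N) : L :=
  \sum_(Pi in ConfII al be) \prod_(D in Pi) strip_weight D.

End Hecke.

(* Main.v *)
(**
Pair the 2's and 1's of [be] like brackets.  On the Kazhdan-Lusztig side, let
C' be the tensor product of the vectors 21 + t^-1 12 over the pairs, of
2 + tN^-1 1 and 2 + (tN/t) 1 over the o- and e-unpaired 2's, and of 1 over the
unpaired 1's.  If [be] has 21 at the positions i, i+1, then
C'_be = (T_i + t^-1) C'_(s_i be), and if [be] ends with a 2, then
C'_be = (T_N + tN^-1) C'_(s_N be), with no further terms; as T_i + t^-1 and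
T_N + tN^-1 are bar-invariant, so is C', and hence C' = C.

On the tiling side, let the depth of a box be the number of boxes of the region
above it in its column.  Rule IIa forces the depth to be constant along a strip
and the strips to be the maximal runs of consecutive columns at a given depth.
Such a run starts at a step where [be] has 2 and [al] has 1, and ends just
before a step where [be] has 1 and [al] has 2, or at the anchor column; the
ballot condition and Rule 0 say that these two steps form a pair of [be], or
that the first one is an unpaired 2.  So a configuration exists only if [al] is
obtained from [be] by flips, it is then unique, and its strips correspond to
the flipped pairs and unpaired 2's; the weights match strip by strip.
*)
Require Import Defs.
From HB Require Import structures.
From mathcomp Require Import all_boot all_order all_algebra all_fingroup.
From mathcomp Require Import reals complex.
From mathcomp Require Import zify.

Set Implicit Arguments.
Unset Strict Implicit.
Unset Printing Implicit Defensive.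

Import Order.TTheory GRing.Theory Num.Theory.
Local Open Scope ring_scope.

(** * The pairing of the letters *)

(** Exchanging two letters of [be] can change its pairing at distant positions. The coefficients of
    C' are therefore computed by one right-to-left reading of both words with a stack: a relation
    between tails that holds for every stack and parity survives any letters put to the right, so
    the exchange is settled locally. The only distant effect is that the unpaired 2's further left
    trade the roles o and e; one identity, for an extra 1 at the right end, absorbs it. The T_N step
    then forces the weights: the first is tN^-1, t times the second is tN, and they repeat with
    period two.

    Bar invariance gives C' = C because every off-diagonal coefficient of C' is 0 or a monomial in
    Gamma_-: a bar-invariant vector whose coefficients all lie in the span of Gamma_- vanishes,
    since bar is triangular and a highest coefficient would be a bar-fixed element of that span. *)

Section Pairing.
Variable N : nat.
Implicit Types (b : word N) (s r : seq 'I_N) (ps : seq ('I_N * 'I_N)).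

Notation reduced b := (pairwise (fun i j : 'I_N => b i ==> b j)).
Notation increasing := (pairwise (fun i j : 'I_N => (i < j)%N)).

Lemma remove21_cons b i j s : remove21 b (i :: j :: s) =
  if b i && ~~ b j then Some ((i, j), s)
  else omap (fun t => (t.1, i :: t.2)) (remove21 b (j :: s)).
Proof. by []. Qed.

Lemma remove21_some b s q s' : remove21 b s = Some (q, s') ->
  exists s1 s2, [/\ s = s1 ++ q.1 :: q.2 :: s2, s' = s1 ++ s2, b q.1 & ~~ b q.2].
Proof.
elim: s q s' => [//|i [//|j s2] IH] q s'; rewrite remove21_cons.
case: ifP => [/andP[bi bj] [<- <-]|_]; first by exists [::], s2.
case E: (remove21 _ _) => [[q0 s0]|] //= [<- <-].
have [s1 [s3 [-> -> bq1 bq2]]] := IH _ _ E.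
by exists (i :: s1), s3.
Qed.

Lemma remove21_none b s : remove21 b s = None -> reduced b s.
Proof.
elim: s => [//|i [//|j s2] IH]; rewrite remove21_cons; case: ifP => [//|nb].
case E: (remove21 _ _) => [//|] _; have red := IH E; rewrite pairwise_cons red andbT.
have bij : b i ==> b j by case: (b i) (b j) nb => [] [].
apply/andP; split=> //; move: red => /= /andP[/allP bj _].
by apply/allP => k /bj; move: bij; case: (b i) (b j) => [] [].
Qed.

(** The induction principle behind all facts on the pairing: a relation between the current
    positions, the pairs and the unpaired rest need only survive the reinsertion of one adjacent
    pair 2,1. *)
Lemma pairing_rec_ind b (P : seq 'I_N -> seq ('I_N * 'I_N) -> seq 'I_N -> Prop) :
    (forall r, reduced b r -> P r [::] r) ->
    (forall s1 (x y : 'I_N) s2 ps r, b x -> ~~ b y -> P (s1 ++ s2) ps r ->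
       P (s1 ++ x :: y :: s2) ((x, y) :: ps) r) ->
  forall n s, (size s <= n)%N -> P s (pairing_rec n b s).1 (pairing_rec n b s).2.
Proof.
move=> Pr Pp; elim=> [|n IH] s; first by case: s => // _; apply: Pr.
move=> sz /=; case E: (remove21 b s) => [[[x y] s']|]; last first.
  by apply: Pr; apply: remove21_none.
have [s1 [s2 [es es' /= bx bNy]]] := remove21_some E.
have := IH s'; case: (pairing_rec n b s') => ps r /= IHs.
rewrite {1}es; apply: Pp => //; rewrite -es'; apply: IHs.
by move: sz; rewrite es es' !size_cat /=; lia.
Qed.

Lemma pairing_ind b (P : seq 'I_N -> seq ('I_N * 'I_N) -> seq 'I_N -> Prop) :
    (forall r, reduced b r -> P r [::] r) ->
    (forall s1 (x y : 'I_N) s2 ps r, b x -> ~~ b y -> P (s1 ++ s2) ps r ->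
       P (s1 ++ x :: y :: s2) ((x, y) :: ps) r) ->
  P (enum 'I_N) (pairing b).1 (pairing b).2.
Proof.
by move=> Pr Pp; apply: pairing_rec_ind => //; rewrite size_enum_ord.
Qed.

Lemma enum_increasing : increasing (enum 'I_N).
Proof.
have: pairwise ltn (map val (enum 'I_N)).
  by rewrite val_enum_ord -sorted_pairwise ?iota_ltn_sorted //; exact: ltn_trans.
by rewrite pairwise_map.
Qed.

Lemma increasing_uniq s : increasing s -> uniq s.
Proof.
elim: s => //= i s IH /andP[/allP lt /IH ->]; rewrite andbT.
by apply/negP => /lt; rewrite ltnn.
Qed.

Lemma increasing_cat2 s1 x y s2 : increasing (s1 ++ x :: y :: s2) ->
  [/\ increasing (s1 ++ s2), (x < y)%N, {in s1, forall i : 'I_N, (i < x)%N}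
    & {in s2, forall i : 'I_N, (y < i)%N}].
Proof.
rewrite !pairwise_cat !allrel_consr /= => /and3P[/and3P[/allP lt1 _ ar] p1].
by case/and3P=> /andP[xy _] /allP lt2 p2; split=> //; rewrite ar p1 p2.
Qed.

Lemma pairing_perm b :
  perm_eq (enum 'I_N)
    (flatten [seq [:: q.1; q.2] | q <- (pairing b).1] ++ (pairing b).2).
Proof.
apply: (@pairing_ind b (fun s ps r => 
  perm_eq s (flatten [seq [:: q.1; q.2] | q <- ps] ++ r))) => //=.
move=> s1 x y s2 ps r _ _ IH.
apply: (@perm_trans _ ([:: x; y] ++ (s1 ++ s2))).
  by rewrite -[x :: y :: s2]/([:: x; y] ++ s2) perm_catCA.
by rewrite /= !perm_cons.
Qed.

Lemma pairing_letters b : {in (pairing b).1, forall q, b q.1 && ~~ b q.2}.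
Proof.
apply: (@pairing_ind b (fun _ ps _ => {in ps, forall q, b q.1 && ~~ b q.2})) => //=.
move=> s1 x y s2 ps r bx by' IH q; rewrite inE => /predU1P[-> /=|/IH //].
by rewrite bx.
Qed.

Lemma pairing_rest b :
  increasing (pairing b).2 /\ reduced b (pairing b).2.
Proof.
move: enum_increasing.
apply: (@pairing_ind b (fun s _ r => increasing s -> increasing r /\ reduced b r)).
  by [].
by move=> s1 x y s2 ps r _ _ IH /increasing_cat2[/IH].
Qed.

(* Heights and the numbers of boxes in the columns of a region are both prefix
   sums of a weight [g] that is opposite on the two letters of a pair. *)
Definition psum (g : 'I_N -> int) s (k : nat) : int := \sum_(i <- s | (i < k)%N) g i.

(** [y] undoes the contribution of [x], so the inserted pair is felt only by prefixes that end
    between them. *)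
Lemma psum_cat2 (g : 'I_N -> int) s1 x y s2 k :
    increasing (s1 ++ x :: y :: s2) -> g x + g y = 0 ->
  psum g (s1 ++ x :: y :: s2) k =
  psum g (s1 ++ s2) k + (if (x < k <= y)%N then g x else 0).
Proof.
move=> /increasing_cat2[_ xy _ _] gxy.
rewrite /psum !big_cat /= !big_cons; set a := bigop _ _ _; set c := bigop _ _ _.
case: (ltnP x k) => xk; case: (ltnP y k) => yk /=; try lia.
Qed.

(** [x] and [y] are neighbours in the current list, so no other position of that list lies between
    them. *)
Lemma psum_flat (g : 'I_N -> int) s1 x y s2 k :
    increasing (s1 ++ x :: y :: s2) -> (x <= k <= y.+1)%N ->
  psum g (s1 ++ s2) k = \sum_(i <- s1) g i.
Proof.
move=> /increasing_cat2[_ xy lt1 lt2] /andP[xk ky]; rewrite /psum big_cat /=.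
rewrite [X in _ + X]big_seq_cond [X in _ + X]big1 ?addr0; last first.
  by move=> i /andP[/lt2 yi ik]; lia.
rewrite [LHS]big_seq_cond [RHS]big_seq_cond; apply: eq_bigl => i.
by case i1: (i \in s1) => //=; move/lt1: i1 => ix; rewrite (leq_trans ix xk).
Qed.

Section PrefixSums.
Variables (b : word N) (g : 'I_N -> int).
Hypothesis g_pairs : {in (pairing b).1, forall q, 0 <= g q.1 /\ g q.1 + g q.2 = 0}.

(** Only complete pairs lie inside a pair; each contributes a nonnegative amount to a prefix and
    nothing once it is closed. *)
Lemma psum_pair : {in (pairing b).1, forall q : 'I_N * 'I_N, [/\ (q.1 < q.2)%N,
  forall k, (q.1 < k <= q.2)%N ->
     psum g (enum 'I_N) q.1 + g q.1 <= psum g (enum 'I_N) k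
  & psum g (enum 'I_N) q.2.+1 = psum g (enum 'I_N) q.1]}.
Proof.
have := g_pairs; have := enum_increasing.
(* The induction must also carry that [q.1] and [q.2] belong to the current list: only then do they
   avoid the interval from [x] to [y]. *)
suff: increasing (enum 'I_N) ->
  {in (pairing b).1, forall q, 0 <= g q.1 /\ g q.1 + g q.2 = 0} ->
  {in (pairing b).1, forall q : 'I_N * 'I_N, [/\ q.1 \in enum 'I_N, q.2 \in enum 'I_N, 
     (q.1 < q.2)%N,
  forall k, (q.1 < k <= q.2)%N ->
     psum g (enum 'I_N) q.1 + g q.1 <= psum g (enum 'I_N) k
  & psum g (enum 'I_N) q.2.+1 = psum g (enum 'I_N) q.1]}.
  by move=> H i1 i2 q /(H i1 i2)[].
apply: (@pairing_ind b (fun s ps _ => increasing s ->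
  {in ps, forall q, 0 <= g q.1 /\ g q.1 + g q.2 = 0} ->
  {in ps, forall q : 'I_N * 'I_N, [/\ q.1 \in s, q.2 \in s, (q.1 < q.2)%N,
    forall k, (q.1 < k <= q.2)%N -> psum g s q.1 + g q.1 <= psum g s k
    & psum g s q.2.+1 = psum g s q.1]})) => // s1 x y s2 ps r _ _ IH inc gps q.
have [inc' xy lt1 lt2] := increasing_cat2 inc.
have [gx gxy] := gps (x, y) (mem_head _ _).
rewrite inE => /predU1P[->|qps] /=.
  split=> //; first by rewrite mem_cat !inE eqxx orbT.
  - by rewrite mem_cat !inE eqxx !orbT.
  - move=> k /andP[xk ky]; rewrite !psum_cat2 // ltnn /= xk ky /= addr0.
    by rewrite !(psum_flat _ inc) //; lia.
  - by rewrite !psum_cat2 // ltnn /= andbC ltnn /= !addr0 !(psum_flat _ inc) //; lia.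
have [|q1 q2 lq le eq0] := IH inc' _ q qps.
  by move=> q' q'ps; apply: gps; rewrite inE q'ps orbT.
have out (i : 'I_N) : i \in s1 ++ s2 -> (i < x)%N || (y < i)%N.
  by rewrite mem_cat => /orP[/lt1 ->|/lt2 ->]; rewrite ?orbT.
have /orP o1 := out _ q1; have /orP o2 := out _ q2.
have mem (i : 'I_N) : i \in s1 ++ s2 -> i \in s1 ++ x :: y :: s2.
  by rewrite !mem_cat !inE => /orP[->|->]; rewrite ?orbT.
split; try exact: mem; try by [].
  move=> k kq; rewrite !psum_cat2 //; have := le _ kq.
  have -> : (x < q.1 <= y)%N = false.
    by case: o1 => lt; [rewrite ltnNge (ltnW lt) | rewrite andbC leqNgt lt].
  by case: ifP => _; rewrite ?addr0 // => /le_trans-> //; rewrite lerDl.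
rewrite !psum_cat2 // eq0.
have -> : (x < q.1 <= y)%N = false.
  by case: o1 => lt; [rewrite ltnNge (ltnW lt) | rewrite andbC leqNgt lt].
have -> // : (x < q.2.+1 <= y)%N = false.
by case: o2 => lt; [rewrite ltnNge lt | rewrite andbC leqNgt (leqW lt)].
Qed.

(** No pair straddles an unpaired position, so beyond [x] the pairs cancel completely. *)
Lemma psum_rest x : x \in (pairing b).2 ->
  psum g (enum 'I_N) N - psum g (enum 'I_N) x =
  psum g (pairing b).2 N - psum g (pairing b).2 x.
Proof.
move=> xr; have := g_pairs; have := enum_increasing; move: xr.
suff: x \in (pairing b).2 -> increasing (enum 'I_N) ->
  {in (pairing b).1, forall q, 0 <= g q.1 /\ g q.1 + g q.2 = 0} ->
  x \in enum 'I_N /\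
  psum g (enum 'I_N) N - psum g (enum 'I_N) x =
  psum g (pairing b).2 N - psum g (pairing b).2 x.
  by move=> H h1 h2 /(H h1 h2)[].
apply: (@pairing_ind b (fun s ps r => x \in r -> increasing s ->
  {in ps, forall q, 0 <= g q.1 /\ g q.1 + g q.2 = 0} ->
  x \in s /\ psum g s N - psum g s x = psum g r N - psum g r x)) => //.
move=> s1 z y s2 ps r _ _ IH xr inc gps.
have [inc' zy lt1 lt2] := increasing_cat2 inc.
have [gz gzy] := gps (z, y) (mem_head _ _).
have [|xs eqs] := IH xr inc'.
  by move=> q' q'ps; apply: gps; rewrite inE q'ps orbT.
have out : (x < z)%N || (y < x)%N.
  by move: xs; rewrite mem_cat => /orP[/lt1 ->|/lt2 ->]; rewrite ?orbT.
split; first by move: xs; rewrite !mem_cat !inE => /orP[->|->]; rewrite ?orbT.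
rewrite !psum_cat2 //.
have -> : (z < N <= y)%N = false by rewrite (leqNgt N) (ltn_ord y) andbF.
rewrite addr0.
have -> : (z < x <= y)%N = false.
  by case/orP: out => lt; [rewrite ltnNge (ltnW lt) | rewrite andbC leqNgt lt].
by rewrite addr0.
Qed.

Lemma psum_unpaired x : x \in (pairing b).2 ->
    {in (pairing b).2, forall i : 'I_N, (x <= i)%N -> 0 <= g i} ->
  forall k, (x < k)%N -> psum g (enum 'I_N) x + g x <= psum g (enum 'I_N) k.
Proof.
move=> xr gr; have := g_pairs; have := enum_increasing; move: xr gr.
suff: x \in (pairing b).2 ->
    {in (pairing b).2, forall i : 'I_N, (x <= i)%N -> 0 <= g i} ->
  increasing (enum 'I_N) ->
  {in (pairing b).1, forall q, 0 <= g q.1 /\ g q.1 + g q.2 = 0} ->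
   x \in enum 'I_N /\
  forall k, (x < k)%N -> psum g (enum 'I_N) x + g x <= psum g (enum 'I_N) k.
  by move=> H h1 h2 h3 /(H h1 h2 h3)[].
apply: (@pairing_ind b (fun s ps r => x \in r ->
    {in r, forall i : 'I_N, (x <= i)%N -> 0 <= g i} -> increasing s ->
  {in ps, forall q, 0 <= g q.1 /\ g q.1 + g q.2 = 0} -> x \in s /\
  forall k, (x < k)%N -> psum g s x + g x <= psum g s k)) => [r _|].
  move=> xr gr inc _; split=> // k xk; case/splitPr: xr inc gr => r1 r2.
  rewrite pairwise_cat allrel_consr /= => /and3P[/andP[/allP l1 _] _].
  move=> /andP[/allP l2 _] gr; rewrite /psum !big_cat /= !big_cons ltnn xk.
  rewrite [X in _ + X + _]big_seq_cond [X in _ + X + _]big1; last first.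
    by move=> i /andP[/l2 /ltnW]; rewrite leqNgt => /negPf->.
  rewrite addr0 lerD //; last first.
    rewrite lerDl big_seq_cond sumr_ge0 // => i /andP[i2 _]; apply: gr.
      by rewrite mem_cat inE i2 !orbT.
    by rewrite ltnW ?l2.
  rewrite [leLHS]big_seq_cond [leRHS]big_seq_cond.
  rewrite le_eqVlt; apply/orP; left; apply/eqP; apply: eq_bigl => i.
  by case i1: (i \in r1) => //=; have ix := l1 _ i1; rewrite ix (ltn_trans ix).
move=> s1 z y s2 ps r _ _ IH xr gr inc gps.
have [inc' zy lt1 lt2] := increasing_cat2 inc.
have [gz gzy] := gps (z, y) (mem_head _ _).
have [|xs le] := IH xr gr inc'.
  by move=> q' q'ps; apply: gps; rewrite inE q'ps orbT.
have out : (x < z)%N || (y < x)%N.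
  by move: xs; rewrite mem_cat => /orP[/lt1 ->|/lt2 ->]; rewrite ?orbT.
split; first by move: xs; rewrite !mem_cat !inE => /orP[->|->]; rewrite ?orbT.
move=> k xk; rewrite !psum_cat2 //; have := le _ xk.
have -> : (z < x <= y)%N = false.
  by case/orP: out => lt; [rewrite ltnNge (ltnW lt) | rewrite andbC leqNgt lt].
by case: ifP => _; rewrite ?addr0 // => /le_trans-> //; rewrite lerDl.
Qed.

Lemma psum_ge0 : {in (pairing b).2, forall i, 0 <= g i} ->
  forall k, 0 <= psum g (enum 'I_N) k.
Proof.
move=> gr k; have := g_pairs; have := enum_increasing; move: gr.
apply: (@pairing_ind b (fun s ps r => {in r, forall i, 0 <= g i} ->
  increasing s -> {in ps, forall q, 0 <= g q.1 /\ g q.1 + g q.2 = 0} ->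
  0 <= psum g s k)) => [r _ gr _ _|].
  by rewrite /psum big_seq_cond sumr_ge0 // => i /andP[/gr].
move=> s1 x y s2 ps r _ _ IH gr inc gps.
have [gx gxy] := gps (x, y) (mem_head _ _).
have [inc' _ _ _] := increasing_cat2 inc.
have := IH gr inc'; rewrite psum_cat2 // => IH'.
rewrite addr_ge0 ?IH' //; last by case: ifP.
by move=> q' q'ps; apply: gps; rewrite inE q'ps orbT.
Qed.

End PrefixSums.

Definition step b (i : 'I_N) : int := if b i then 1 else -1.

Lemma step_pairs b :
  {in (pairing b).1, forall q, 0 <= step b q.1 /\ step b q.1 + step b q.2 = 0}.
Proof. by move=> q /pairing_letters/andP[b1 b2]; rewrite /step b1 (negPf b2). Qed.

Lemma psum_enum (g : 'I_N -> int) k :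
  psum g (enum 'I_N) k = \sum_(i < N | (i < k)%N) g i.
Proof. by rewrite /psum big_enum_cond. Qed.

Lemma heightE b k : height b k = psum (step b) (enum 'I_N) k.
Proof. by rewrite psum_enum. Qed.

Lemma psumS (g : 'I_N -> int) (i : 'I_N) :
  psum g (enum 'I_N) i.+1 = psum g (enum 'I_N) i + g i.
Proof.
rewrite !psum_enum (bigD1 i) //= addrC; congr (_ + _).
by apply: eq_bigl => j; rewrite ltnS ltn_neqAle andbC -(inj_eq val_inj).
Qed.

Lemma unpaired_reduced b x : x \in unpaired2_seq b ->
  {in (pairing b).2, forall i : 'I_N, (x <= i)%N -> b i}.
Proof.
rewrite mem_filter => /andP[bx xr] i ir xi.
have [inc red] := pairing_rest b.
case/splitPr: xr inc red ir => r1 r2; rewrite !pairwise_cat !allrel_consr /=.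
case/and3P=> /andP[/allP l1 _] _ _ /and3P[_ _ /andP[/allP imp _]].
rewrite mem_cat inE => /or3P[/l1|/eqP->|/imp] //.
  by rewrite ltnNge xi.
by rewrite bx.
Qed.

(** Beyond an unpaired 2 the pairs cancel and every unpaired letter is a 2, so the gain in height
    counts the unpaired 2's from [x] on. This ties the alternation o/e to the parity of [l'] in a
    strip. *)
Lemma rank_height b x : x \in unpaired2 b ->
  (rank_from_right b x).+1%:Z = height b N - height b x.
Proof.
rewrite inE => xu; have xu' := xu; move: xu'; rewrite mem_filter => /andP[bx xr].
rewrite !heightE (psum_rest (@step_pairs b) xr) /psum.
have [inc red] := pairing_rest b; have bi := unpaired_reduced xu.
have incu : increasing (unpaired2_seq b) by exact: pairwise_filter.
have -> : \sum_(i <- (pairing b).2 | (i < N)%N) step b i -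
   \sum_(i <- (pairing b).2 | (i < x)%N) step b i =
   \sum_(i <- (pairing b).2 | (x <= i)%N) step b i.
  rewrite (bigID (fun i : 'I_N => (i < x)%N)) /=.
  under eq_bigl do rewrite ltn_ord /=.
  under [X in _ + X - _]eq_bigl do rewrite ltn_ord /= -leqNgt.
  by rewrite addrC addrA addNr add0r.
rewrite big_seq_cond (eq_bigr (fun=> 1)); last first.
  by move=> i /andP[ir xi]; rewrite /step bi.
rewrite -big_seq_cond.
have -> : \sum_(i <- (pairing b).2 | (x <= i)%N) (1 : int) =
          \sum_(i <- unpaired2_seq b | (x <= i)%N) 1.
  rewrite big_filter_cond big_seq_cond [RHS]big_seq_cond; apply: eq_bigl => i.
  case ir: (i \in _) => //=; case xi: (x <= i)%N; rewrite ?andbF //=.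
  by rewrite (bi _ ir xi).
rewrite /rank_from_right; case/splitPr: xu incu => u1 u2.
rewrite pairwise_cat allrel_consr /= => /and3P[/andP[/allP l1 _] _ /andP[/allP l2 _]].
have xu2 : x \notin u2 by apply/negP => /l2; rewrite ltnn.
rewrite rev_cat rev_cons cat_rcons index_cat mem_rev (negPf xu2) /= eqxx addn0.
rewrite size_rev big_cat big_cons leqnn /= big_seq_cond big1 ?add0r; last first.
  by move=> i /andP[/l1 ix]; rewrite leqNgt ix.
rewrite big_seq_cond (eq_bigl (mem u2)).
  by rewrite -big_seq big_const_seq count_predT; elim: (size u2) => //=; lia.
by move=> i /=; case iu: (i \in u2) => //=; rewrite ltnW ?l2.
Qed.

End Pairing.

(** * Partners read off from heights, and flips read letter by letter *)

Section Flipped.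
Variable N : nat.
Implicit Types (al be b : word N) (i x y : 'I_N).

Lemma pairing_cover b i :
  i \in (pairing b).2 \/ exists2 q, q \in (pairing b).1 & i \in [:: q.1; q.2].
Proof.
have := mem_enum 'I_N i; rewrite (perm_mem (pairing_perm b)) mem_cat inE.
by case/orP=> [/flatten_mapP[q ? ?]|]; [right; exists q | left].
Qed.

Lemma pairing_uniq b :
  uniq (flatten [seq [:: q.1; q.2] | q <- (pairing b).1] ++ (pairing b).2).
Proof. by rewrite -(perm_uniq (pairing_perm b)) enum_uniq. Qed.

Lemma pairing_inj b q q' i : q \in (pairing b).1 -> q' \in (pairing b).1 ->
  i \in [:: q.1; q.2] -> i \in [:: q'.1; q'.2] -> q = q'.
Proof.
have := pairing_uniq b; rewrite cat_uniq => /andP[+ _].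
elim: (pairing b).1 => // q0 ps IH.
rewrite -[flatten _]/([:: q0.1; q0.2] ++ flatten [seq [:: q.1; q.2] | q <- ps]).
rewrite cat_uniq => /and3P[_ /hasPn dis un].
have nodis q1 : q1 \in ps -> i \in [:: q1.1; q1.2] -> i \notin [:: q0.1; q0.2].
  by move=> q1s iq; apply: dis; apply/flatten_mapP; exists q1.
move=> + + iq iq'; rewrite 2!in_cons => /predU1P[eq|qs] /predU1P[eq'|q's].
- by rewrite eq.
- by have := nodis _ q's iq'; rewrite -eq iq.
- by have := nodis _ qs iq; rewrite -eq' iq'.
- exact: IH.
Qed.

Lemma pairing_rest_disjoint b q i : q \in (pairing b).1 -> i \in [:: q.1; q.2] ->
  i \notin (pairing b).2.
Proof.
have := pairing_uniq b; rewrite cat_uniq => /and3P[_ /hasPn dis _] qs iq.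
apply/negP => /dis/negP; apply; apply/flatten_mapP; by exists q.
Qed.

Lemma pairing_uniq1 b : uniq (pairing b).1.
Proof.
have := pairing_uniq b; rewrite cat_uniq => /andP[+ _].
elim: (pairing b).1 => //= q ps IH /and3P[]; rewrite inE negb_or => /andP[_ nq] _.
move=> /IH ->; rewrite andbT; apply/negP => qs; case/negP: nq.
by apply/flatten_mapP; exists q; rewrite ?inE ?eqxx.
Qed.

Lemma pair_height b q : q \in (pairing b).1 -> [/\ (q.1 < q.2)%N,
  forall k, (q.1 < k <= q.2)%N -> height b q.1 + 1 <= height b k
  & height b q.2.+1 = height b q.1].
Proof.
move=> qs; have [lt le eqh] := psum_pair (@step_pairs _ b) qs.
have /andP[b1 _] := pairing_letters qs.
by split; rewrite ?heightE // => k /le; rewrite heightE /step b1.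
Qed.

Lemma unpaired_height b x : x \in unpaired2_seq b ->
  forall k, (x < k)%N -> height b x + 1 <= height b k.
Proof.
move=> xu k xk; have := xu; rewrite mem_filter => /andP[bx xr].
rewrite !heightE; have := psum_unpaired (@step_pairs _ b) xr.
have -> : step b x = 1 by rewrite /step bx.
by apply=> // i ir xi; rewrite /step (unpaired_reduced xu ir xi).
Qed.

Lemma first_or_unpaired b x : b x ->
  x \in unpaired2_seq b \/ exists y, (x, y) \in (pairing b).1.
Proof.
move=> bx; case: (pairing_cover b x) => [xr|[[x' y] qs]].
  by left; rewrite mem_filter bx.
rewrite !inE => /orP[/eqP->|/eqP /= xy]; first by right; exists y.
by have := pairing_letters qs; rewrite /= -xy bx andbF.
Qed.

(** A 2 is paired exactly when the path returns to its starting height, and the partner is the step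
    of the first return; two candidates would contradict each other's minimality. *)
Lemma mem_pairing b x y : b x -> (x < y)%N -> height b y.+1 = height b x ->
    (forall k, (x < k <= y)%N -> height b x + 1 <= height b k) ->
  (x, y) \in (pairing b).1.
Proof.
move=> bx xy hy hk; have [xu|[y' qs]] := first_or_unpaired bx.
  by have := unpaired_height xu (k := y.+1); rewrite hy => /(_ (ltnW xy)); lia.
suff -> : y = y' by [].
have [/= xy' hk' hy'] := pair_height qs.
apply/val_inj => /=; case: (ltngtP y y') => // lt.
- by have := hk' y.+1; rewrite hy lt ltnS (ltnW xy) => /(_ isT); lia.
- by have := hk y'.+1; rewrite hy' lt ltnS (ltnW xy') => /(_ isT); lia.
Qed.

Lemma mem_unpaired2 b x : b x ->
    (forall k, (x < k <= N)%N -> height b x + 1 <= height b k) ->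
  x \in unpaired2_seq b.
Proof.
move=> bx hk; have [//|[y qs]] := first_or_unpaired bx.
have [/= xy _ hy] := pair_height qs.
by have := hk y.+1; rewrite hy ltn_ord ltnS (ltnW xy) => /(_ isT); lia.
Qed.

(** Membership in [FA be] without the flipped sets. Both sides of the main identity vanish when it
    fails. *)
Definition compatible al be : bool :=
  all (fun q => al q.1 != al q.2) (pairing be).1 &&
  all (fun i => be i || ~~ al i) (pairing be).2.

Lemma FA_compatible al be : (al \in FA be) = compatible al be.
Proof.
apply/idP/andP => [/imset2P[A B]|[/allP cp /allP cr]].
  rewrite !powersetE => /subsetP sA /subsetP sB ->.
  have inB q i : q \in (pairing be).1 -> i \in [:: q.1; q.2] -> i \in B = false.
    move=> qs iq; apply/negP => /sB; rewrite inE mem_filter.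
    by rewrite (negPf (pairing_rest_disjoint qs iq)) andbF.
  have inA q i : q \in (pairing be).1 -> i \in [:: q.1; q.2] ->
      [exists p in A, (i == p.1) || (i == p.2)] = (q \in A).
    move=> qs iq; apply/existsP/idP => [[p /andP[pA ip]]|qA]; last first.
      by exists q; rewrite qA; move: iq; rewrite !inE.
    suff -> : q = p by [].
    by apply: (pairing_inj qs _ iq); [have := sA _ pA; rewrite inE | rewrite !inE].
  split; apply/allP.
    move=> q qs; rewrite !ffunE !(inA q) ?(inB q) ?inE ?eqxx ?orbT //.
    by have /andP[-> /negPf->] := pairing_letters qs; case: ifP.
  move=> i ir; rewrite !ffunE; case bi: (be i) => //=.
  rewrite ifF; first by case: ifP.
  apply/negbTE/existsPn => p; apply/negP => /andP[/sA]; rewrite inE => ps.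
  move=> ip; have := pairing_rest_disjoint ps (i := i); rewrite !inE ip ir.
  by move/(_ isT).
pose A := [set p in pairs be | al p.1 != be p.1].
pose B := [set i in unpaired2 be | ~~ al i].
apply/imset2P; exists A B.
- by rewrite powersetE; apply/subsetP => p; rewrite inE => /andP[].
- by rewrite powersetE; apply/subsetP => p; rewrite inE => /andP[].
apply/ffunP => i; rewrite !ffunE; case: (pairing_cover be i) => [ir|[q qs iq]].
  rewrite ifF; last first.
    apply/negbTE/existsPn => p; apply/negP => /andP[]; rewrite inE => /andP[].
    rewrite inE => ps _ ip; have := pairing_rest_disjoint ps (i := i).
    by rewrite !inE ip ir => /(_ isT).
  rewrite !inE mem_filter ir andbT; have := cr _ ir.
  by case: (be i) (al i) => [] [].
have /andP[b1 /negPf b2] := pairing_letters qs; have := cp _ qs.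
have -> : [exists p in A, (i == p.1) || (i == p.2)] = (al q.1 != be q.1).
  apply/existsP/idP => [[p /andP[]]|nq].
    rewrite !inE => /andP[ps np ip]; suff -> : q = p by [].
    by apply: (pairing_inj qs ps iq); rewrite !inE.
  by exists q; rewrite !inE qs nq; move: iq; rewrite !inE.
have -> : i \in B = false.
  by rewrite !inE mem_filter (negPf (pairing_rest_disjoint qs iq)) andbF.
move: iq; rewrite !inE => /orP[]/eqP->; rewrite b1 ?b2;
  by case: (al q.1) (al q.2) => [] [].
Qed.

End Flipped.

(** * The coefficients of the canonical basis *)

Section Coefficients.
Variables (L : comUnitRingType) (t tN : L).
Hypotheses (t_unit : t \is a GRing.unit) (tN_unit : tN \is a GRing.unit).

(** [p] is the parity of the number of unpaired 2's further right, so [false] is the o-case. *)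
Definition unpaired_weight (p : bool) : L := if p then tN / t else tN^-1.

Definition pair_weight (a a' : bool) : L :=
  if a == a' then 0 else if a then 1 else t^-1.

(* [z] lists the letters of [al] and [be], from right to left.  [S] is the stack of
   the letters of [al] at the 1's of [be] that still wait for their 2, and [p] is
   the parity of the number of unpaired 2's read so far. *)
Fixpoint scan (z : seq (bool * bool)) (S : seq bool) (p : bool) : L :=
  match z with
  | [::] => (all negb S)%:R
  | (a, b) :: z' =>
    if b then
      if S is s :: S' then pair_weight a s * scan z' S' p
      else (if a then 1 else unpaired_weight p) * scan z' [::] (~~ p)
    else scan z' (a :: S) p
  end.

(** The letters of [y] only multiply by a scalar and update stack and parity, in the same way for
    all three tails. *)
Lemma scan_lin c1 c2 z z1 z2 :
    (forall S p, scan z S p = c1 * scan z1 S p + c2 * scan z2 S p) ->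
  forall y S p,
  scan (y ++ z) S p = c1 * scan (y ++ z1) S p + c2 * scan (y ++ z2) S p.
Proof.
move=> H; elim=> [|[a b] y IH] S p; first exact: H.
case: b => /=; last exact: IH.
by case: S => [|s S]; rewrite IH mulrDr !(mulrCA _ c1) !(mulrCA _ c2).
Qed.

Lemma scan_pair y a a' z S p :
  scan (y ++ (a', false) :: (a, true) :: z) S p =
  pair_weight a a' * scan (y ++ z) S p.
Proof.
rewrite (scan_lin (c1 := pair_weight a a') (c2 := 0) (z1 := z) (z2 := z)).
  by rewrite mul0r addr0.
by move=> {}S {}p; rewrite mul0r addr0.
Qed.

(* The new bottom of the stack stands for one more 1 to the right of the word,
   which turns the first unpaired 2 into a paired one; whence the parity [~~ p]. *)
Lemma scan_empty z S p :
  scan z S p =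
  scan z (rcons S false) (~~ p) + t * unpaired_weight p * scan z (rcons S true) (~~ p).
Proof.
elim: z S p => [|[a b] z IH] S p /=.
  by rewrite !all_rcons /= mulr0 addr0.
case: b; last by rewrite IH.
case: S => [|s S] /=; last by rewrite IH mulrDr mulrCA.
rewrite /pair_weight; case: a => /=; first by rewrite mul0r mulr0 addr0.
by rewrite mul0r add0r mulrA -[t * _ * _]mulrA mulrCA mulrV // mulr1.
Qed.

(** This is the action of T_i + t^-1 in coordinates. Adjacent 2,1 form a pair; after the exchange
    the 2 uses the top of the stack, or becomes unpaired if the stack is empty. *)
Lemma scan_swap ai aj y z S p :
  scan (y ++ (aj, false) :: (ai, true) :: z) S p =
  if ai == aj then 0
  else (if ai then t else t^-1) * scan (y ++ (aj, true) :: (ai, false) :: z) S p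
       + scan (y ++ (ai, true) :: (aj, false) :: z) S p.
Proof.
case: ifPn => [/eqP->|nij].
  by rewrite scan_pair /pair_weight eqxx mul0r.
rewrite (scan_lin (c1 := if ai then t else t^-1)
  (z1 := (aj, true) :: (ai, false) :: z) (c2 := 1)
  (z2 := (ai, true) :: (aj, false) :: z)) ?mul1r // => {}S {}p /=.
have tV : t^-1 * t = 1 by rewrite mulVr.
have tV' : t * t^-1 = 1 by rewrite mulrV.
(* Nonempty stack: [s] equals [ai] or [aj], and [pair_weight] vanishes on equal letters, so just one
   term on the right survives. Empty stack: [scan_empty] compensates for the changed parity. *)
case: S => [|s S]; last first.
  rewrite /pair_weight; case: ai aj s nij => [] [] [] //= _;
  by rewrite ?mul0r ?mulr0 ?mul1r ?mulrA ?tV ?tV' ?mul0r ?mul1r ?addr0 ?add0r.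
rewrite /pair_weight [scan z [::] p]scan_empty /=.
case: ai aj nij => [] [] //= _; rewrite !mul1r ?mulrA; first by rewrite addrC.
by rewrite mulrDr !mulrA tV mul1r.
Qed.

(** This is the action of T_N + tN^-1 in coordinates. It is [scan_empty] at odd parity, where t *
    (tN/t) = tN is the eigenvalue needed; the e-weight has its value for this reason. *)
Lemma scan_last a z :
  scan ((a, true) :: z) [::] false =
  (if a then tN else tN^-1) * scan ((a, false) :: z) [::] false
  + scan ((~~ a, false) :: z) [::] false.
Proof.
rewrite /= [scan z [::] true]scan_empty /= mulrCA mulrV // mulr1.
case: a => /=; first by rewrite mul1r addrC.
by rewrite mulrDr mulrA mulVr // mul1r.
Qed.

Variable N : nat.
Implicit Types (al be : word N).

Definition letters al be (s : seq 'I_N) := [seq (al i, be i) | i <- rev s].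

Definition kl_coef al be : L := scan (letters al be (enum 'I_N)) [::] false.

Definition rest_weight al be (i : 'I_N) : L :=
  if be i then if al i then 1 else unpaired_weight (odd (rank_from_right be i))
  else (~~ al i)%:R.

Lemma scan_letters_rest al be r :
    pairwise (fun i j : 'I_N => be i ==> be j) r -> uniq r ->
    unpaired2_seq be = filter be r ->
  scan (letters al be r) [::] false = \prod_(i <- r) rest_weight al be i.
Proof.
move=> red un ur.
(* [r2] is the part already read. It consists of unpaired 2's, so its size is the 0-based rank from
   the right of the next position. *)
suff H r1 r2 : r = r1 ++ r2 -> all be r2 ->
    scan (letters al be r1) [::] (odd (size r2)) = \prod_(i <- r1) rest_weight al be i.
  by have := H r [::]; rewrite cats0; apply.
elim/last_ind: r1 r2 => [|r1 x IH] r2 er b2; first by rewrite big_nil.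
rewrite /letters rev_rcons map_cons -/(letters al be r1) big_rcons /=.
rewrite [rest_weight al be x]/rest_weight; case bx: (be x).
  rewrite -/(odd (size (x :: r2))) (IH (x :: r2)) ?er ?cat_rcons //= ?bx //.
  rewrite mulrC; congr (_ * (if _ then 1 else unpaired_weight (odd _))).
  rewrite /rank_from_right ur er cat_rcons filter_cat /= bx rev_cat rev_cons cat_rcons.
  rewrite index_cat mem_rev; move: un; rewrite er cat_rcons cat_uniq /=.
  case/and4P=> _ _ xr2 _; rewrite mem_filter (negPf xr2) andbF /= eqxx addn0.
  by rewrite size_rev (all_filterP b2).
(* Left of the first 1 met in this reading there are only 1's, so from here on the stack is filled
   and never popped. *)
have bN : {in r1, forall i, ~~ be i}.
  move: red; rewrite er cat_rcons pairwise_cat allrel_consr.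
  by case/and3P=> /andP[/allP b1 _] _ _ i /b1; rewrite bx implybF.
have allS S p : scan (letters al be r1) S p =
    ((all negb S) && all (fun i => ~~ al i) r1)%:R.
  elim/last_ind: r1 {IH er} bN S p => [|r1 i IH] bN S p /=.
    by rewrite andbT.
  rewrite /letters rev_rcons map_cons /= -/(letters al be r1).
  rewrite (negPf (bN i _)) ?mem_rcons ?mem_head // IH ?all_rcons /=.
    by rewrite andbCA andbA.
  by move=> j jr; apply: bN; rewrite mem_rcons inE jr orbT.
rewrite allS /= andbT.
rewrite (eq_big_seq (fun i => (~~ al i)%:R)); last first.
  by move=> i /bN/negPf bi; rewrite /rest_weight bi.
elim: r1 {IH er bN allS} => [|i r1 IH] /=; first by rewrite big_nil mul1r andbT.
rewrite big_cons -mulrA -IH; case: (al i) => /=; rewrite ?mul1r //.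
by rewrite mul0r andbF.
Qed.

(** [scan_pair] deletes an adjacent 2,1 from the word just as the pairing does. The scan serves the
    recursion, this product the size estimates and the flip formula. *)
Lemma kl_coefE al be :
  kl_coef al be = \prod_(q <- (pairing be).1) pair_weight (al q.1) (al q.2) *
                  \prod_(i <- (pairing be).2) rest_weight al be i.
Proof.
have [inc red] := pairing_rest be.
rewrite -(scan_letters_rest _ red (increasing_uniq inc)) // /kl_coef.
move: [::] false => S p.
apply: (@pairing_ind N be (fun s ps r => scan (letters al be s) S p =
  \prod_(q <- ps) pair_weight (al q.1) (al q.2) * scan (letters al be r) S p)).
  by move=> r _; rewrite big_nil mul1r.
move=> s1 x y s2 ps r bx /negPf by' IH; rewrite big_cons -mulrA -IH.
rewrite /letters rev_cat !rev_cons -!cats1 -!catA !cat1s !map_cat !map_cons bx by'.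
by rewrite scan_pair rev_cat map_cat.
Qed.

Lemma kl_coef_compatible al be : ~~ compatible al be -> kl_coef al be = 0.
Proof.
rewrite kl_coefE /compatible => /nandP[] /allPn[x xs].
  rewrite negbK => /eqP e; rewrite (perm_big _ (perm_to_rem xs)) big_cons /=.
  by rewrite /pair_weight e eqxx !mul0r.
rewrite negb_or negbK => /andP[/negPf bx ax].
rewrite [X in _ * X](perm_big _ (perm_to_rem xs)) big_cons /=.
by rewrite /rest_weight bx ax mul0r mulr0.
Qed.

Lemma enum_split (i j : 'I_N) : j = i.+1 :> nat ->
  exists s1 s2, [/\ enum 'I_N = s1 ++ i :: j :: s2,
    i \notin s1, j \notin s1, i \notin s2 & j \notin s2].
Proof.
move=> ij; have un := enum_uniq 'I_N; have inc := enum_increasing N.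
have lti : (i < size (enum 'I_N))%N by rewrite size_enum_ord.
have ltj : (i.+1 < size (enum 'I_N))%N by rewrite size_enum_ord -ij.
have e : enum 'I_N = take i (enum 'I_N) ++ i :: j :: drop i.+2 (enum 'I_N).
  rewrite -{1}(cat_take_drop i (enum 'I_N)) (drop_nth i lti) (drop_nth i ltj).
  by rewrite nth_ord_enum -{1}ij nth_ord_enum.
exists (take i (enum 'I_N)), (drop i.+2 (enum 'I_N)); move: un; rewrite {1}e.
rewrite cat_uniq /= !inE !negb_or.
case/and3P=> _ /and3P[i1 j1 _] /andP[/andP[_ i2] /andP[j2 _]].
by split.
Qed.

Lemma kl_coef_swap al be (i j : 'I_N) : j = i.+1 :> nat -> be i -> ~~ be j ->
  kl_coef al be =
  if al i == al j then 0
  else (if al i then t else t^-1) * kl_coef al (swap_letters i j be)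
       + kl_coef (swap_letters i j al) (swap_letters i j be).
Proof.
move=> ij bi /negPf bj; have [s1 [s2 [e i1 j1 i2 j2]]] := enum_split ij.
have tp (s : seq 'I_N) : i \notin s -> j \notin s ->
    {in s, forall k, tperm i j k = k}.
  move=> ni nj k ks; rewrite tpermD //; first by apply: contraNneq ni => ->.
  by apply: contraNneq nj => ->.
rewrite /kl_coef /letters e !rev_cat !rev_cons -!cats1 -!catA !cat1s.
rewrite !map_cat !map_cons !ffunE tpermL tpermR bi bj scan_swap.
have E s (u v : word N) : i \notin s -> j \notin s ->
  [seq (u k, swap_letters i j v k) | k <- rev s] = [seq (u k, v k) | k <- rev s].
  move=> ni nj; apply/eq_in_map => k; rewrite mem_rev => ks.
  by rewrite ffunE (tp s).
have E' s (u v : word N) : i \notin s -> j \notin s ->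
  [seq (swap_letters i j u k, v k) | k <- rev s] = [seq (u k, v k) | k <- rev s].
  move=> ni nj; apply/eq_in_map => k; rewrite mem_rev => ks.
  by rewrite ffunE (tp s).
by rewrite !E // !E'.
Qed.

Lemma kl_coef_flip al be (i : 'I_N) : i.+1 = N -> be i ->
  kl_coef al be =
  (if al i then tN else tN^-1) * kl_coef al (flip_letter i be)
  + kl_coef (flip_letter i al) (flip_letter i be).
Proof.
move=> iN bi.
have e : enum 'I_N = rcons (take i (enum 'I_N)) i.
  rewrite -{1}(cat_take_drop i (enum 'I_N)) (drop_nth i) ?size_enum_ord //.
  rewrite drop_oversize ?size_enum_ord ?iN // cats1; congr rcons.
  by apply/val_inj; rewrite /= nth_enum_ord.
have := enum_uniq 'I_N; rewrite e rcons_uniq => /andP[ni _].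
rewrite /kl_coef /letters e rev_rcons !map_cons !ffunE eqxx bi scan_last.
congr (_ * scan (_ :: _) _ _ + scan (_ :: _) _ _); apply/eq_in_map => k.
  by rewrite mem_rev ffunE => ks; case: eqP => // kE; move: ks; rewrite kE (negPf ni).
by rewrite mem_rev !ffunE => ks; case: eqP => // kE; move: ks; rewrite kE (negPf ni).
Qed.

End Coefficients.

(** * Bruhat order through the number of 2's in prefixes *)

Section Rank.
Variable N : nat.
Implicit Types (al be b : word N).

Definition twos b (k : nat) : int := psum (fun i => (b i)%:R) (enum 'I_N) k.

Lemma twos0 b : twos b 0 = 0.
Proof. by rewrite /twos psum_enum big1. Qed.

Lemma twosS b (i : 'I_N) : twos b i.+1 = twos b i + (b i)%:R.
Proof. exact: psumS. Qed.

Lemma twos_ge0 b k : 0 <= twos b k.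
Proof. by rewrite /twos psum_enum sumr_ge0. Qed.

Lemma twos_le b k : (k <= N)%N -> twos b k <= k%:Z.
Proof.
elim: k => [|k IH] kN; first by rewrite twos0.
have := twosS b (Ordinal kN); have := IH (ltnW kN) => /=.
by case: (b _) => /=; lia.
Qed.

Lemma twos_diff b j k : (j <= k <= N)%N ->
  twos b j <= twos b k <= twos b j + (k - j)%N%:Z.
Proof.
elim: k => [|k IH] /andP[jk kN]; first by move: jk; rewrite leqn0 => /eqP->; lia.
move: jk; rewrite leq_eqVlt => /predU1P[->|jk]; first by lia.
have := twosS b (Ordinal kN); have := IH; rewrite (ltnW kN) andbT -ltnS => /(_ jk) /=.
by case: (b _) => /=; lia.
Qed.

Lemma heightS b (i : 'I_N) : height b i.+1 = height b i + step b i.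
Proof. by rewrite !heightE psumS. Qed.

Lemma height_twos b k : (k <= N)%N -> height b k = 2 * twos b k - k%:Z.
Proof.
elim: k => [|k IH] kN; first by rewrite twos0 /height big1.
have := IH (ltnW kN); have := twosS b (Ordinal kN).
have := heightS b (Ordinal kN); rewrite /step /=.
by case: (b _) => /=; lia.
Qed.

Lemma onesS b (i : 'I_N) : ones b i.+1 = (ones b i + ~~ b i)%N.
Proof.
rewrite /ones (cardsD1 i) addnC !inE ltnSn; congr (_ + _)%N; apply: eq_card => j.
rewrite !inE ltnS [(j < i)%N]ltn_neqAle -(inj_eq val_inj) /=.
by case: eqP => //= _; rewrite andbF.
Qed.

Lemma ones_twos b k : (k <= N)%N -> (ones b k)%:Z = k%:Z - twos b k.
Proof.
elim: k => [|k IH] kN.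
  by rewrite twos0 /ones (eq_card (B := pred0)) ?card0 // => i; rewrite !inE.
have := IH (ltnW kN); have := twosS b (Ordinal kN).
have := onesS b (Ordinal kN) => /=.
by case: (b _) => /=; lia.
Qed.

Lemma leB_twos al be :
  reflect (forall k, (k <= N)%N -> twos al k <= twos be k) (leB al be).
Proof.
apply: (iffP forallP) => H k.
  move=> kN; have := H (Ordinal (kN : (k < N.+1)%N)) => /=.
  by rewrite -lez_nat !ones_twos //; lia.
have kN : (k <= N)%N by rewrite -ltnS.
by rewrite -lez_nat !ones_twos //; have := H k kN; lia.
Qed.

(** A statistic that strictly increases along the Bruhat order; it is the induction measure for
    every triangularity argument. *)
Definition rank b : nat := \sum_(i < N) `|twos b i.+1|%N.

Lemma rank_lt al be : leB al be -> al != be -> (rank al < rank be)%N.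
Proof.
move=> /leB_twos le ne.
have [i ni] : exists i : 'I_N, twos al i.+1 != twos be i.+1.
  apply/existsP; apply: contraNT ne => /existsPn eq; apply/eqP/ffunP => i.
  have eqt k : (k <= N)%N -> twos al k = twos be k.
    case: k => [|k] kN; first by rewrite !twos0.
    by have := eq (Ordinal kN); rewrite negbK => /eqP.
  have := twosS al i; have := twosS be i; rewrite !eqt ?(ltnW (ltn_ord i)) // => ->.
  by move/addrI; case: (al i) (be i) => [] [].
rewrite /rank (bigD1 i) //= [ltnRHS](bigD1 i) //= -addSn leq_add //.
  have := le i.+1 (ltn_ord i); have := twos_ge0 al i.+1; have := twos_ge0 be i.+1.
  by lia.
apply: leq_sum => j _; have := le j.+1 (ltn_ord j).
by have := twos_ge0 al j.+1; have := twos_ge0 be j.+1; lia.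
Qed.

(** Covers both moves: an exchange at i, i+1, and the change of the last letter, for which the
    condition at i+1 is vacuous. *)
Lemma rank_lower al be (i : 'I_N) :
    (forall k : 'I_N, (k < i)%N -> al k = be k) -> be i -> ~~ al i ->
    (forall k : 'I_N, k = i.+1 :> nat -> ~~ be k && al k) ->
    (forall k : 'I_N, (i.+1 < k)%N -> al k = be k) ->
  (rank al < rank be)%N.
Proof.
move=> lt bi /negPf ai eq gt.
have tw k : (k <= N)%N -> twos al k = twos be k - (k == i.+1)%:R.
  elim: k => [|k IH] kN; first by rewrite !twos0.
  have := twosS al (Ordinal kN); have := twosS be (Ordinal kN) => /= -> ->.
  rewrite (IH (ltnW kN)) eqSS; case: (ltngtP k i) => ki.
  - by rewrite (lt (Ordinal kN)) // ltn_eqF ?subr0 // ltnW.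
  - case: (ltngtP k i.+1) => [lt1|gt1|eq1]; first by rewrite ltnS leqNgt ki in lt1.
      by rewrite (gt (Ordinal kN)) //= !subr0.
    have /andP[/negPf-> ->] := eq (Ordinal kN) eq1.
    by rewrite subrK addr0 subr0.
  - have -> : Ordinal kN = i by exact: val_inj.
    by rewrite ai bi ki ltn_eqF // subr0 addrK addr0.
apply: rank_lt.
  by apply/leB_twos => k kN; rewrite tw // lerBlDr lerDl.
by apply/eqP => e; rewrite e bi in ai.
Qed.

(** The difference of the letters is opposite on each pair and nonnegative on its first letter and
    on the unpaired positions, so its prefix sums are nonnegative. *)
Lemma compatible_leB al be : compatible al be -> leB al be.
Proof.
move=> /andP[/allP cp /allP cr]; apply/leB_twos => k kN; rewrite -subr_ge0.
pose g i : int := (be i)%:R - (al i)%:R.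
have -> : twos be k - twos al k = psum g (enum 'I_N) k by rewrite /psum sumrB.
apply: (psum_ge0 (b := be)) => [q qs|i ir]; rewrite /g.
  have := cp _ qs; have /andP[-> /negPf->] := pairing_letters qs.
  by case: (al q.1) (al q.2) => [] [].
by have := cr _ ir; case: (be i) (al i) => [] [].
Qed.

End Rank.

(** * The Kazhdan-Lusztig basis *)

Section Laurent.
Variables (C : fieldType) (L : comUnitAlgType C) (t tN : L).
Hypothesis laurentL : is_laurent t tN.
Variable barL : {lrmorphism L -> L}.
Hypotheses (barL_t : barL t = t^-1) (barL_tN : barL tN = tN^-1).

Definition mono (k : int * int) : L := t ^ k.1 * tN ^ k.2.

(** The exponents of Gamma_-: the lexicographically negative pairs, closed under addition and
    disjoint from their opposites. *)
Definition negative (k : int * int) : bool :=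
  (k.1 < 0) || ((k.1 == 0) && (k.2 < 0)).

(** Coefficients in [C] absorb the integers of [in_Zspan]; the list is [uniq] to match the freeness
    clause of [is_laurent]. *)
Definition neg_span (x : L) : Prop := exists (s : seq (int * int)) (c : int * int -> C),
  [/\ uniq s, all negative s & x = \sum_(k <- s) c k *: mono k].

Lemma t_unit : t \is a GRing.unit. Proof. by case: laurentL. Qed.
Lemma tN_unit : tN \is a GRing.unit. Proof. by case: laurentL. Qed.

Lemma monoD k l : mono (k.1 + l.1, k.2 + l.2) = mono k * mono l.
Proof. by rewrite /mono /= !exprzDr ?t_unit ?tN_unit // mulrACA. Qed.

Lemma barL_mono k : barL (mono k) = mono (- k.1, - k.2).
Proof.
rewrite /mono rmorphM !rmorphXz ?t_unit ?tN_unit //= barL_t barL_tN.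
by rewrite !exprz_inv.
Qed.

Lemma neg_span0 : neg_span 0.
Proof. by exists [::], (fun=> 0); rewrite big_nil. Qed.

Lemma neg_span_mono a k : negative k -> neg_span (a *: mono k).
Proof. by move=> nk; exists [:: k], (fun=> a); rewrite big_seq1 /= nk. Qed.

Lemma widen_sum (s s' : seq (int * int)) (c : int * int -> C) :
    uniq s -> uniq s' -> {subset s <= s'} ->
  \sum_(k <- s) c k *: mono k = \sum_(k <- s') (if k \in s then c k else 0) *: mono k.
Proof.
move=> us us' ss'; rewrite [RHS](eq_bigr (fun k => if k \in s then c k *: mono k else 0)).
  rewrite -big_mkcond -big_filter; apply: perm_big; apply: uniq_perm => //.
    exact: filter_uniq.
  by move=> k; rewrite mem_filter; case ks: (k \in s) => //=; rewrite (ss' _ ks).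
by move=> k _; case: ifP => _; rewrite ?scale0r.
Qed.

Lemma neg_spanD x y : neg_span x -> neg_span y -> neg_span (x + y).
Proof.
move=> [s1 [c1 [u1 n1 ->]]] [s2 [c2 [u2 n2 ->]]].
exists (undup (s1 ++ s2)).
exists (fun k => (if k \in s1 then c1 k else 0) + (if k \in s2 then c2 k else 0)).
split; first exact: undup_uniq.
  by apply/allP => k; rewrite mem_undup mem_cat => /orP[/(allP n1)|/(allP n2)].
have un := undup_uniq (s1 ++ s2).
rewrite (widen_sum c1 u1 un) ?(widen_sum c2 u2 un).
- by rewrite -big_split; apply: eq_bigr => k _; rewrite scalerDl.
- by move=> k ks; rewrite mem_undup mem_cat ks orbT.
- by move=> k ks; rewrite mem_undup mem_cat ks.
Qed.

Lemma neg_spanZ a x : neg_span x -> neg_span (a *: x).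
Proof.
move=> [s [c [us ns ->]]]; exists s, (fun k => a * c k); split=> //.
by rewrite scaler_sumr; apply: eq_bigr => k _; rewrite scalerA.
Qed.

Lemma neg_spanN x : neg_span x -> neg_span (- x).
Proof. by rewrite -scaleN1r; apply: neg_spanZ. Qed.

Lemma in_Zspan_neg x : in_Zspan (GammaA_neg t tN) x -> neg_span x.
Proof.
move=> [s [c [sG ->]]]; elim: s sG => [|g s IH] sG.
  by rewrite big_nil; exact: neg_span0.
rewrite big_cons; apply: neg_spanD; last first.
  by apply: IH => h hs; apply: sG; rewrite inE hs orbT.
have [k nk ->] : exists2 k, negative k & g = mono k.
  have [h [[i [j [i0 ->]]]|[i [i0 ->]]] ->] := sG g (mem_head _ _).
    exists (- i, - j); first by rewrite /negative /= oppr_lt0 i0.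
    by rewrite invrM ?unitrXz ?t_unit ?tN_unit // !invr_expz mulrC.
  exists (0, - i); first by rewrite /negative /= oppr_lt0 i0.
  by rewrite invr_expz /mono expr0z mul1r.
by rewrite -scaler_int; apply: neg_span_mono.
Qed.

(** Bar is [C]-linear and negates exponents, so [x - barL x] involves pairwise distinct monomials,
    and freeness kills every coefficient. *)
Lemma neg_span_bar x : neg_span x -> barL x = x -> x = 0.
Proof.
case: laurentL => _ _ _ free [s [c [us ns xE]]] bx.
pose opp (k : int * int) := (- k.1, - k.2).
have oppK : involutive opp by case=> a b; rewrite /opp /= !opprK.
pose c' k := if k \in s then c k else - c (opp k).
have disj k : k \in s -> opp k \notin s.
  move=> ks; apply/negP => /(allP ns); move/(allP ns): ks; rewrite /negative /=.
  by lia.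
have un : uniq (s ++ map opp s).
  rewrite cat_uniq us (map_inj_uniq (inv_inj oppK)) us andbT /=.
  by apply/hasPn => _ /mapP[k ks ->]; exact: disj.
have z : \sum_(k <- s ++ map opp s) c' k *: mono k = 0.
  suff -> : \sum_(k <- s ++ map opp s) c' k *: mono k = x - barL x.
    by rewrite bx subrr.
  rewrite big_cat big_map xE raddf_sum -sumrN; congr (_ + _); apply: eq_big_seq => k ks.
    by rewrite /c' ks.
  by rewrite /c' (negPf (disj _ ks)) oppK /= linearZ /= barL_mono scaleNr.
rewrite xE big_seq big1 // => k ks.
have := free _ _ un z k; rewrite mem_cat ks /c' ks => -> //.
by rewrite scale0r.
Qed.

Definition small (x : L) : Prop := x = 0 \/ exists2 k, negative k & x = mono k.

Lemma small_neg_span x : small x -> neg_span x.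
Proof.
case=> [->|[k nk ->]]; first exact: neg_span0.
by rewrite -[mono k]scale1r; apply: neg_span_mono.
Qed.

Lemma smallM x y : small x -> y = 1 \/ small y -> small (x * y).
Proof.
case=> [->|[k nk ->]]; first by left; rewrite mul0r.
case=> [->|[->|[l nl ->]]]; rewrite ?mulr1 ?mulr0; [by right; exists k | by left |].
right; exists (k.1 + l.1, k.2 + l.2); last by rewrite monoD.
by move: nk nl; rewrite /negative /=; lia.
Qed.

Lemma small_prod (I : Type) (s : seq I) (F : I -> L) :
  (forall i, F i = 1 \/ small (F i)) ->
  \prod_(i <- s) F i = 1 \/ small (\prod_(i <- s) F i).
Proof.
move=> H; elim: s => [|i s IH]; first by left; rewrite big_nil.
rewrite big_cons; case: (H i) => [->|si]; first by rewrite mul1r.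
by right; apply: smallM.
Qed.

Lemma small_tV : small t^-1.
Proof. by right; exists (-1, 0); rewrite // /mono expr0z mulr1. Qed.

Lemma small_unpaired p : small (unpaired_weight t tN p).
Proof.
right; case: p; [exists (-1, 1) | exists (0, -1)]; rewrite // /mono /=.
  by rewrite mulrC.
by rewrite mul1r.
Qed.

Variable N : nat.
Implicit Types (al be : word N).

Lemma small_pair a a' : pair_weight t a a' = 1 \/ small (pair_weight t a a').
Proof.
rewrite /pair_weight; case: ifP => _; first by right; left.
by case: a; [left | right; exact: small_tV].
Qed.

Lemma small_rest al be i : rest_weight t tN al be i = 1 \/ small (rest_weight t tN al be i).
Proof.
rewrite /rest_weight; case: (be i); case: (al i); try by [left].
  by right; exact: small_unpaired.
by right; left.
Qed.

(** A position where the words differ lies in a factor that is small, and all other factors are 1 or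
    small. *)
Lemma kl_coef_small al be : al != be -> small (kl_coef t tN al be).
Proof.
move=> ne; rewrite kl_coefE ?t_unit //.
have [i ni] : exists i, al i != be i.
  by apply/existsP; apply: contraNT ne => /existsPn eq; apply/eqP/ffunP => i;
     have := eq i; rewrite negbK => /eqP.
case: (pairing_cover be i) => [ir|[q qs iq]].
  rewrite mulrC (perm_big _ (perm_to_rem ir)) big_cons -mulrA; apply: smallM.
    rewrite /rest_weight; case: (be i) (al i) ni => [] [] // _; last by left.
    exact: small_unpaired.
  case: (small_prod (rem i (pairing be).2) (fun j => small_rest al be j)) => [->|s].
    by rewrite mul1r; apply: small_prod => q; exact: small_pair.
  by right; apply: smallM => //; apply: small_prod => q; exact: small_pair.
rewrite (perm_big _ (perm_to_rem qs)) big_cons -mulrA; apply: smallM.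
  have /andP[b1 /negPf b2] := pairing_letters qs; move: iq ni.
  rewrite !inE /pair_weight => /orP[]/eqP->; rewrite ?b1 ?b2.
    by case: (al q.1) (al q.2) => [] [] //= _; [exact: small_tV | left].
  by case: (al q.1) (al q.2) => [] [] //= _; [left | exact: small_tV].
case: (small_prod (rem q (pairing be).1) (fun p => small_pair (al p.1) (al p.2))) => [->|s].
  by rewrite mul1r; apply: small_prod => j; exact: small_rest.
by right; apply: smallM => //; apply: small_prod => j; exact: small_rest.
Qed.

End Laurent.

Lemma kl_coef_diag (L : comUnitRingType) (t tN : L) (N : nat) (b : word N) :
  t \is a GRing.unit -> kl_coef t tN b b = 1.
Proof.
move=> tu; rewrite kl_coefE // [X in X * _]big_seq [X in X * _]big1 ?mul1r.
  rewrite big1 // => i _; rewrite /rest_weight; by case: ifP => // ->.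
move=> q /pairing_letters/andP[b1 /negPf b2].
by rewrite /pair_weight b1 b2.
Qed.

Lemma kl_coef_rank (L : comUnitRingType) (t tN : L) (N : nat) (al be : word N) :
    t \is a GRing.unit -> kl_coef t tN al be != 0 -> al != be ->
  (rank al < rank be)%N.
Proof.
move=> tu nz; apply: rank_lt; apply: compatible_leB.
by apply: contraNT nz => /(kl_coef_compatible t tN)->.
Qed.

(** * Bar invariance of the vectors C' and triangularity of bar *)

Section BarInvariance.
Variables (L : comUnitRingType) (t tN : L) (N : nat).
Hypotheses (t_unit : t \is a GRing.unit) (tN_unit : tN \is a GRing.unit).
Variables (barL : {rmorphism L -> L}).
Hypotheses (barL_t : barL t = t^-1) (barL_tN : barL tN = tN^-1).
Variables (H : algType L) (T : 'I_N -> H).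
Hypothesis heckeT : heckeB_relations t tN T.
Variable barH : {lrmorphism H -> H | barL \; *:%R}.
Hypothesis barH_T : forall i, T i * barH (T i) = 1 /\ barH (T i) * T i = 1.
Variables (M : lmodType H) (m : word N -> M).
Hypothesis minusM : is_Mminus t tN T m.
Variable barM : {linear M -> M | barH \; *:%R}.
Hypothesis barM_all1 : barM (m (all1 N)) = m (all1 N).
Implicit Types (a b : word N) (f g : word N -> L) (c d : L).

Lemma barH_scalar c : barH c%:A = (barL c)%:A.
Proof. by rewrite linearZ /= rmorph1. Qed.

Lemma barM_Z h v : barM (h *: v) = barH h *: barM v.
Proof. by rewrite linearZ. Qed.

Lemma scalarC h c (v : M) : h *: (c%:A *: v) = c%:A *: (h *: v).
Proof. by rewrite !scalerA mulr_algl mulr_algr. Qed.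

Lemma scalarM c d : (c * d)%:A = c%:A * d%:A :> H.
Proof. by rewrite mulr_algl scalerA. Qed.

(* From (T - x)(T + x^-1) = 0 one gets bar T = T^-1 = T - x + x^-1. *)
Lemma bar_quadratic (x : L) (i : 'I_N) : x \is a GRing.unit -> barL x = x^-1 ->
    (T i - x%:A) * (T i + x^-1%:A) = 0 ->
  barH (T i + x^-1%:A) = T i + x^-1%:A.
Proof.
move=> ux bx quad; rewrite rmorphD /= barH_scalar rmorphV // bx invrK.
have [_ bT] := barH_T i.
have TT : T i * (T i - x%:A + x^-1%:A) = 1.
  apply/eqP; rewrite -subr_eq0 -[X in _ == X]quad; apply/eqP.
  rewrite mulrDl !mulrDr mulrN !mulNr -scalarM mulrV // scale1r.
  rewrite mulr_algl mulr_algr.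
  rewrite -!addrA; congr (_ + _); exact: addrCA.
have -> : barH (T i) = T i - x%:A + x^-1%:A.
  by rewrite -[LHS]mulr1 -[X in _ * X]TT mulrA bT mul1r.
by rewrite addrAC subrK.
Qed.

Definition vec f : M := \sum_a (f a)%:A *: m a.

Lemma vec_inj f g : vec f = vec g -> f =1 g.
Proof.
case: minusM => basis _ _ e a; have [c [_ uc]] := basis (vec f).
have vE h : vec h = \sum_a (([ffun a => h a] : {ffun word N -> L}) a)%:A *: m a.
  by apply: eq_bigr => b _; rewrite ffunE.
have e1 := uc _ (vE f); have := uc [ffun a => g a]; rewrite -vE e e1.
by move=> /(_ erefl)/ffunP/(_ a); rewrite !ffunE.
Qed.

Lemma eq_vec f g : f =1 g -> vec f = vec g.
Proof. by move=> fg; apply: eq_bigr => a _; rewrite fg. Qed.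

Lemma vecD f g : vec f + vec g = vec (fun a => f a + g a).
Proof.
by rewrite /vec -big_split; apply: eq_bigr => a _; rewrite !scalerDl.
Qed.

Lemma vecZ c f : c%:A *: vec f = vec (fun a => c * f a).
Proof.
by rewrite scaler_sumr; apply: eq_bigr => a _; rewrite scalerA scalarM.
Qed.

Lemma vec_single b : m b = vec (fun a => (a == b)%:R).
Proof.
rewrite /vec (bigD1 b) //= eqxx scale1r scale1r big1 ?addr0 // => a /negPf->.
by rewrite !scale0r.
Qed.

(** The common shape of T_i + t^-1 and T_N + tN^-1: [s] is the move on words, and [p] singles out
    the words that are not killed, namely those with distinct letters at i, i+1 in the first case
    and all words in the second. *)
Lemma vec_act (h : H) (w : word N -> L) (s : word N -> word N) (p : pred (word N)) f :
    involutive s -> (forall a, p (s a) = p a) ->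
    (forall a, h *: m a = if p a then m (s a) + (w a)%:A *: m a else 0) ->
  h *: vec f = vec (fun a => if p a then w a * f a + f (s a) else 0).
Proof.
move=> sK ps hm; rewrite scaler_sumr.
transitivity (\sum_(a | p a) ((f a)%:A *: m (s a) + (w a * f a)%:A *: m a)).
  rewrite [RHS]big_mkcond; apply: eq_bigr => a _; rewrite scalarC hm.
  by case: ifP => _; rewrite ?scaler0 // scalerDr scalerA -scalarM mulrC.
rewrite big_split /= (reindex_inj (inv_inj sK)) /= (eq_bigl _ _ ps).
rewrite -big_split [RHS](bigID p) /= [X in _ + X]big1 ?addr0.
  by apply: eq_bigr => a pa; rewrite pa sK addrC scalerDl scalerDl.
by move=> a /negPf->; rewrite !scale0r.
Qed.

Lemma swapK (i j : 'I_N) : involutive (@swap_letters N i j).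
Proof. by move=> a; apply/ffunP => k; rewrite !ffunE tpermK. Qed.

Lemma flipK (i : 'I_N) : involutive (@flip_letter N i).
Proof. by move=> a; apply/ffunP => k; rewrite !ffunE; case: eqP; rewrite ?negbK. Qed.

Definition canonical_vec b : M := vec (fun a => kl_coef t tN a b).

Lemma canonical_swap b (i j : 'I_N) : j = i.+1 :> nat -> b i -> ~~ b j ->
  canonical_vec b = (T i + t^-1%:A) *: canonical_vec (swap_letters i j b).
Proof.
move=> ij bi bj.
rewrite (@vec_act _ (fun a => if a i then t else t^-1)
  (@swap_letters N i j) (fun a => a i != a j)).
- apply: eq_vec => a; rewrite (kl_coef_swap tN t_unit a ij bi bj) //.
  by case: eqP.
- exact: swapK.
- by move=> a; rewrite !ffunE tpermL tpermR eq_sym.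
move=> a; case: minusM => _ Tm _; rewrite scalerDl (Tm _ _ _ ij).
case: eqP => [|/eqP nij] /=; first by rewrite -scalerDl -scalerDl addNr !scale0r.
case ai: (a i) (a j) nij => [] [] //= _.
by rewrite -addrA -scalerDl -scalerDl subrK.
Qed.

Lemma canonical_flip b (i : 'I_N) : i.+1 = N -> b i ->
  canonical_vec b = (T i + tN^-1%:A) *: canonical_vec (flip_letter i b).
Proof.
move=> iN bi.
rewrite (@vec_act _ (fun a => if a i then tN else tN^-1)
  (@flip_letter N i) xpredT).
- by apply: eq_vec => a; rewrite (kl_coef_flip t_unit tN_unit a iN bi).
- exact: flipK.
- by [].
move=> a; case: minusM => _ _ Tm; rewrite scalerDl (Tm _ _ iN).
by case: (a i) => //=; rewrite -addrA -scalerDl -scalerDl subrK.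
Qed.

Lemma canonical_all1 : canonical_vec (all1 N) = m (all1 N).
Proof.
rewrite vec_single; apply: eq_vec => a; case: eqP => [->|/eqP ne].
  by rewrite kl_coef_diag.
apply/eqP; apply: contraT => nz; have := kl_coef_rank t_unit nz ne.
rewrite /rank [X in (_ < X)%N]big1 // => i _.
by rewrite /twos psum_enum big1 // => j _; rewrite ffunE.
Qed.

Lemma canonical_bar b : barM (canonical_vec b) = canonical_vec b.
Proof.
have [n] := ubnP (rank b); elim: n b => // n IH b; rewrite ltnS => rb.
have [Ti TN] : (forall i : 'I_N, (i.+1 < N)%N -> barH (T i + t^-1%:A) = T i + t^-1%:A) /\
    (forall i : 'I_N, i.+1 = N -> barH (T i + tN^-1%:A) = T i + tN^-1%:A).
  by case: heckeT => _ _ _ q1 q2; split=> i iN; apply: bar_quadratic; auto.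
case: (pickP b) => [i0 bi0|b0]; last first.
  have -> : b = all1 N by apply/ffunP => i; rewrite ffunE b0.
  by rewrite canonical_all1.
(* The rightmost 2 is either followed by a 1 or the last letter, so one of the two recursions
   applies and lowers the rank. *)
case: (@arg_maxnP _ i0 (fun i => b i) (fun i => i : nat) bi0) => i bi imax.
have bgt (k : 'I_N) : (i < k)%N -> b k = false.
  by move=> ik; apply/negP => /imax le; have := leq_trans ik le; rewrite ltnn.
case: (ltnP i.+1 N) => iN.
  pose j := Ordinal iN; have bj : ~~ b j by rewrite bgt //=.
  rewrite (canonical_swap (j := j) erefl bi bj) barM_Z Ti // IH //.
  apply: leq_trans rb; apply: (rank_lower (i := i)) => //.
  - move=> k ki; rewrite ffunE tpermD //; apply/eqP => e; move: ki; rewrite -e /=; lia.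
  - by rewrite ffunE tpermL.
  - move=> k ki; have -> : k = j by exact: val_inj.
    by rewrite ffunE tpermR bi bj.
  - move=> k ki; rewrite ffunE tpermD //; apply/eqP => e; move: ki; rewrite -e /=; lia.
have {}iN : i.+1 = N by apply/eqP; rewrite eqn_leq iN ltn_ord.
rewrite (canonical_flip iN bi) barM_Z TN // IH //.
apply: leq_trans rb; apply: (rank_lower (i := i)) => //.
- by move=> k ki; rewrite ffunE; case: eqP => // e; move: ki; rewrite e ltnn.
- by rewrite ffunE eqxx bi.
- by move=> k ki; have := ltn_ord k; rewrite ki iN ltnn.
- by move=> k ki; have := ltn_ord k; rewrite -{2}iN ltnNge ltnW.
Qed.

(** Triangularity is drawn from the vectors C' instead of from the action on [m]: they are
    bar-invariant and unitriangular, so subtracting those of top rank, with the coefficients of [f],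
    leaves a vector of lower rank. *)
Lemma bar_triangular n f : (forall a, (n <= rank a)%N -> f a = 0) ->
  exists g, [/\ barM (vec f) = vec g, forall a, (n <= rank a)%N -> g a = 0
    & forall a, n = (rank a).+1 -> g a = barL (f a)].
Proof.
elim: n f => [|n IH] f f0.
  exists (fun=> 0); split=> //; rewrite /vec !big1 ?raddf0 // => a _.
    by rewrite !scale0r.
  by rewrite f0 // !scale0r.
pose top := \sum_(b | rank b == n) (f b)%:A *: canonical_vec b.
pose k a := \sum_(b | rank b == n) f b * kl_coef t tN a b.
pose bk a := \sum_(b | rank b == n) barL (f b) * kl_coef t tN a b.
have sumv (c : word N -> L) : \sum_(b | rank b == n) (c b)%:A *: canonical_vec b =
    vec (fun a => \sum_(b | rank b == n) c b * kl_coef t tN a b).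
  rewrite (eq_bigr _ (fun b _ => vecZ _ _)) /vec exchange_big; apply: eq_bigr => a _.
  by rewrite scaler_suml scaler_suml.
have kE (c : word N -> L) a : (n <= rank a)%N ->
    \sum_(b | rank b == n) c b * kl_coef t tN a b = if rank a == n then c a else 0.
  move=> na; rewrite (eq_bigr (fun b => if b == a then c b else 0)).
    rewrite -big_mkcondr /= (eq_bigl (fun b => (rank a == n) && (b == a))).
      case: ifP => _; first by rewrite big_pred1_eq.
      by rewrite big_pred0.
    by move=> b; rewrite andbC; case: eqP => [->|]; rewrite ?andbT ?andbF.
  move=> b /eqP rb; case: (eqVneq b a) => [->|ne].
    by rewrite kl_coef_diag ?mulr1.
  have [->|nz] := eqVneq (kl_coef t tN a b) 0; first by rewrite mulr0.
  by have := kl_coef_rank t_unit nz; rewrite eq_sym rb ltnNge na => /(_ ne).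
have [|g1 [bg1 g10 _]] := IH (fun a => f a - k a).
  move=> a na; rewrite /k kE //; case: eqP => [_|/eqP ne]; first by rewrite subrr.
  by rewrite f0 ?subrr // ltn_neqAle eq_sym ne.
exists (fun a => bk a + g1 a); split=> [|a na|a [na]].
- have -> : vec f = vec k + vec (fun a => f a - k a).
    by rewrite vecD; apply: eq_vec => a; rewrite addrC subrK.
  rewrite raddfD /= bg1 -vecD; congr (_ + _).
  rewrite -sumv -[RHS]sumv raddf_sum; apply: eq_bigr => b _.
  by rewrite -[LHS]/(barM _) barM_Z barH_scalar canonical_bar.
- by rewrite /bk kE ?(ltnW na) // gtn_eqF // g10 ?addr0 // ltnW.
- by rewrite /bk kE -?na // eqxx g10 ?addr0 // na.
Qed.

End BarInvariance.

Section Uniqueness.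
Variables (C : fieldType) (L : comUnitAlgType C) (t tN : L).
Hypothesis laurentL : is_laurent t tN.
Variable barL : {lrmorphism L -> L}.
Hypotheses (barL_t : barL t = t^-1) (barL_tN : barL tN = tN^-1).
Variables (N : nat) (H : algType L) (T : 'I_N -> H).
Hypothesis heckeT : heckeB_relations t tN T.
Variable barH : {lrmorphism H -> H | barL \; *:%R}.
Hypothesis barH_T : forall i, T i * barH (T i) = 1 /\ barH (T i) * T i = 1.
Variables (M : lmodType H) (m : word N -> M).
Hypothesis minusM : is_Mminus t tN T m.
Variable barM : {linear M -> M | barH \; *:%R}.
Hypothesis barM_all1 : barM (m (all1 N)) = m (all1 N).

(** By triangularity a coefficient of top rank is fixed by bar; being in the negative span it is
    zero, and the bound on the rank descends. *)
Lemma bar_invariant_neg (f : word N -> L) :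
    barM (vec m f) = vec m f -> (forall a, neg_span t tN (f a)) ->
  forall a, f a = 0.
Proof.
have tu := t_unit laurentL; have tNu := tN_unit laurentL.
move=> bf nf.
have vanish n : (forall a, (n <= rank a)%N -> f a = 0) -> forall a, f a = 0.
  elim: n => [|n IH] f0 a; first exact: f0.
  apply: IH => {}a; rewrite leq_eqVlt => /predU1P[na|]; last exact: f0.
  have [g [bg _ gf]] := bar_triangular tu tNu barL_t barL_tN heckeT barH_T minusM
    barM_all1 f0.
  apply: (neg_span_bar laurentL barL_t barL_tN (nf a)).
  by rewrite -[LHS]gf ?na // (vec_inj minusM (etrans (esym bg) bf)).
apply: (vanish (\max_a rank a).+1) => a; rewrite ltnNge.
by move/negP; case; apply: leq_bigmax.
Qed.

Variables (Cb : word N -> M) (P : word N -> word N -> L).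
Hypothesis klP : is_KL t tN m barM Cb P.

Lemma tdiff_diag (b : word N) : tdiff t tN b b = 1.
Proof.
by rewrite /tdiff mulrV // unitrM !unitrX ?(t_unit laurentL) ?(tN_unit laurentL).
Qed.

Lemma kl_coef_unique al be : leB al be ->
  tdiff t tN al be * P al be = kl_coef t tN al be.
Proof.
have tu := t_unit laurentL; have tNu := tN_unit laurentL.
case: klP => _ barC CE Pd Pn le.
(* Extending by zero outside the Bruhat interval makes the comparison run over all words. *)
pose x a := if leB a be then tdiff t tN a be * P a be else 0.
have CE' : Cb be = vec m x.
  rewrite CE /vec [RHS](bigID (fun a => leB a be)) /= [X in _ = _ + X]big1 ?addr0.
    by apply: eq_bigr => a ab; rewrite /x ab.
  by move=> a /negPf ab; rewrite /x ab !scale0r.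
suff /(_ al) : forall a, x a - kl_coef t tN a be = 0.
  by rewrite /x le => /eqP; rewrite subr_eq0 => /eqP.
have vE : vec m (fun a => x a - kl_coef t tN a be) = Cb be - canonical_vec t tN m be.
  rewrite CE' /canonical_vec /vec -sumrB; apply: eq_bigr => a _.
  by rewrite !scalerBl.
apply: bar_invariant_neg.
  rewrite vE raddfB /= barC (canonical_bar tu tNu barL_t barL_tN heckeT barH_T minusM) //.
move=> a; have [->|ne] := eqVneq a be.
  rewrite kl_coef_diag // /x; case: ifP => [_|/negP[]]; last exact/forallP.
  by rewrite Pd tdiff_diag mulr1 subrr; exact: neg_span0.
apply: neg_spanD.
  rewrite /x; case: ifP => [ab|_]; last exact: neg_span0.
  by apply: in_Zspan_neg => //; exact: Pn.
by apply: neg_spanN; apply: small_neg_span; apply: kl_coef_small.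
Qed.

End Uniqueness.

Lemma prod_if_const (R : comUnitRingType) (I : finType) (s : seq I) (S : {set I}) (c : R) :
    uniq s -> {subset S <= s} ->
  \prod_(i <- s) (if i \in S then c else 1) = c ^+ #|S|.
Proof.
move=> us Ss; rewrite big_uniq //= -prodr_const [RHS]big_mkcond [LHS]big_mkcond.
apply: eq_bigr => i _; case: ifP => // is'.
by case: ifP => // /Ss; rewrite is'.
Qed.

Section FlipFormula.
Variables (L : comUnitRingType) (t tN : L).
Hypotheses (t_unit : t \is a GRing.unit) (tN_unit : tN \is a GRing.unit).
Variable N : nat.
Implicit Types (al be : word N).

Lemma kl_coef_FA al be : compatible al be ->
  kl_coef t tN al be = t ^- dA al be * tN ^- dAo al be * (t / tN) ^- dAe al be.
Proof.
move=> /andP[/allP cp /allP cr]; rewrite kl_coefE -mulrA; congr (_ * _).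
  rewrite -exprVn -(prod_if_const (s := (pairing be).1)) ?pairing_uniq1 //.
    apply: eq_big_seq => q qs; rewrite inE [q \in _]inE qs /pair_weight (negPf (cp _ qs)).
    by have /andP[-> _] := pairing_letters qs; case: (al q.1).
  by move=> q; rewrite inE => /andP[]; rewrite inE.
have ur : uniq (pairing be).2 by have [inc _] := pairing_rest be; exact: increasing_uniq.
have sub (S : {set 'I_N}) : {subset S <= unpaired2 be} ->
    {subset [set i in S | al i != be i] <= (pairing be).2}.
  by move=> sS i; rewrite inE => /andP[/sS]; rewrite inE mem_filter => /andP[].
rewrite -!exprVn -(prod_if_const _ ur (sub _ _)); last by move=> i; rewrite inE => /andP[].
rewrite -(prod_if_const _ ur (sub _ _)); last by move=> i; rewrite inE => /andP[].
rewrite -big_split; apply: eq_big_seq => i ir /=.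
rewrite !inE !mem_filter ir andbT /rest_weight /unpaired_weight.
have := cr _ ir; case: (be i) (al i) => [] [] //= _; rewrite ?andbF ?mulr1 //.
rewrite !andbT invrM ?unitrV // invrK.
by case: odd => /=; rewrite ?mulr1 ?mul1r.
Qed.

End FlipFormula.

(** * Ballot strips *)

Section Boxes.
Variable N : nat.
Notation box := ('I_N * 'I_(N.*2.+1))%type.
Implicit Types (b : box) (D : {set box}).

Lemma pos_inj : injective (@pos N).
Proof.
move=> [u v] [u' v'] []; rewrite /= => e1 /(addIr _)[e2].
by congr (_, _); apply/val_inj; rewrite /= ?e2; lia.
Qed.

Lemma box_eq b b' : b.1 = b'.1 :> nat -> (pos b).2 = (pos b').2 -> b = b'.
Proof. by move=> e1 e2; apply: pos_inj; rewrite /pos e1 -[RHS]/(_, (pos b').2) -e2. Qed.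

(** A strip as a function of the column offset, in place of a tuple of boxes: [f k] is its box in
    column [x + k]. *)
Record ballot_param (l l' : nat) D (x : nat) (f : nat -> box) : Prop := BallotParam {
  bp_col : forall k, (k <= l.*2 + l')%N -> (f k).1 = (x + k)%N :> nat;
  bp_mem : forall b, b \in D <-> exists2 k, (k <= l.*2 + l')%N & b = f k;
  bp_step : forall k, (k < l.*2 + l')%N ->
    (pos (f k.+1)).2 = (pos (f k)).2 + 1 \/ (pos (f k.+1)).2 = (pos (f k)).2 - 1;
  bp_min : forall k, (k <= l.*2 + l')%N -> (pos (f 0)).2 <= (pos (f k)).2;
  bp_end : (pos (f (l.*2 + l')%N)).2 = (pos (f 0)).2 + l'%:Z }.

Lemma ballot_stripP l l' D :
  ballot_strip l l' D <-> exists x f, ballot_param l l' D x f.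
Proof.
set n := (l.*2 + l')%N; split.
  case/existsP=> -[s szs0] /andP[/= bal /eqP ->].
  have /eqP szs : size s == n.+1 by [].
  have b0 : box by case: (s) szs.
  pose f k := nth b0 s k.
  have sE : map (@pos N) s = pos (f 0) :: behead (map (@pos N) s).
    by rewrite /f; case: (s) szs.
  have nthE k : (k <= n)%N -> nth (0, 0) (map (@pos N) s) k = pos (f k).
    by move=> kn; rewrite (nth_map b0) ?szs.
  move: bal; rewrite sE => /and3P[/(pathP (0, 0)) pth /allP mn /eqP lst].
  have szb : size (behead (map (@pos N) s)) = n by rewrite size_behead size_map szs.
  have stp k : (k < n)%N -> path_step (pos (f k)) (pos (f k.+1)).
    move=> kn; have := pth k; rewrite szb -sE => /(_ kn).
    by rewrite nth_behead !nthE // ltnW.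
  have col k : (k <= n)%N -> (f k).1 = ((f 0).1 + k)%N :> nat.
    elim: k => [|k IH] kn; first by rewrite addn0.
    by have /andP[/eqP c _] := stp k kn; have := IH (ltnW kn); move: c => /=; lia.
  exists (f 0).1, f; split=> //.
  - move=> b; rewrite inE; split=> [bs|[k kn ->]].
      exists (index b s); first by rewrite -ltnS -szs index_mem.
      by rewrite /f nth_index.
    by rewrite mem_nth // szs ltnS.
  - by move=> k kn; have /andP[_ /orP[]/eqP e] := stp k kn; [left | right].
  - move=> [|k] kn //; apply: mn; rewrite -nthE // sE /= mem_nth ?szb //.
  - have lastE : last (pos (f 0)) (behead (map (@pos N) s)) = pos (f n).
      by rewrite -(nthE n) // sE (last_nth (0, 0)) szb.
    by rewrite -lastE lst.
case=> x [f [col mem stp mn en]].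
have szs : size (mkseq f n.+1) == n.+1 by rewrite size_mkseq.
apply/existsP; exists (Tuple szs); apply/andP; split; last first.
  apply/eqP/setP => b; rewrite inE; apply/idP/mapP => [/mem[k kn ->]|[k]].
    by exists k; rewrite // mem_iota.
  by rewrite mem_iota => kn ->; apply/mem; exists k.
pose q := map (@pos N \o f) (iota 1 n).
have -> : map (@pos N) (Tuple szs) = pos (f 0) :: q by rewrite /q map_comp.
have nthE j : (j <= n)%N -> nth (0, 0) (pos (f 0) :: q) j = pos (f j).
  by case: j => [|j] jn //=; rewrite (nth_map 0%N) ?size_iota // nth_iota.
have szq : size q = n by rewrite size_map size_iota.
apply/and3P; split.
- apply/(pathP (0, 0)) => k; rewrite szq => kn.
  have -> : nth (0, 0) q k = pos (f k.+1) by rewrite -nthE.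
  rewrite nthE ?(ltnW kn) //; apply/andP; split.
    by rewrite /= !col ?(ltnW kn) //; lia.
  by case: (stp k kn) => ->; rewrite eqxx ?orbT.
- apply/allP => _ /mapP[k + ->]; rewrite mem_iota => /andP[_ kn]; exact: mn.
- rewrite (last_nth (0, 0)) szq nthE //; apply/eqP/eqP.
  by rewrite /eq_op /= -/n; apply/andP; split; [rewrite !col //; lia | apply/eqP].
Qed.

Lemma ballot_param_inj l l' D x f b b' : ballot_param l l' D x f ->
  b \in D -> b' \in D -> b.1 = b'.1 :> nat -> b = b'.
Proof.
move=> [col mem _ _ _] /mem[k kn ->] /mem[k' kn' ->].
by rewrite !col // => /addnI->.
Qed.

End Boxes.

(** * Column sizes and depths in a region *)

Section Depth.
Variables (N : nat) (al be : word N).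
Notation box := ('I_N * 'I_(N.*2.+1))%type.
Notation reg := (region al be).
Implicit Types (b : box) (D : {set box}).

(* The number of boxes of the region in the column of first coordinate [k]. *)
Definition kappa (k : nat) : int := twos be k - twos al k.

Lemma kappa0 : kappa 0 = 0.
Proof. by rewrite /kappa !twos0. Qed.

Lemma kappaS (i : 'I_N) : kappa i.+1 = kappa i + (be i)%:R - (al i)%:R.
Proof. by rewrite /kappa !twosS; lia. Qed.

(** The boxes of a column are 2 apart, the topmost being centred 1 below the path [be], so the
    quotient is the number of boxes above [b]. *)
Definition depth b : int := ((height be b.1.+1 - 1 - (pos b).2) %/ 2)%Z.

Lemma depth_unique b (c : int) : (pos b).2 = height be b.1.+1 - 1 - 2 * c -> depth b = c.
Proof. by move=> e; rewrite /depth e; lia. Qed.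

Hypothesis le : leB al be.

Lemma kappa_ge0 k : (k <= N)%N -> 0 <= kappa k.
Proof. by move=> kN; rewrite subr_ge0; move/leB_twos: le; apply. Qed.

Lemma regionP b : reflect
  (0 <= depth b < kappa b.1.+1 /\ (pos b).2 = height be b.1.+1 - 1 - 2 * depth b)
  (b \in reg).
Proof.
have uN : (b.1.+1 <= N)%N := ltn_ord b.1.
have hb := height_twos be uN; have ha := height_twos al uN.
have tb := twos_le be uN; have ta := twos_ge0 al b.1.+1.
have k0 := kappa_ge0 uN; move: k0; rewrite /kappa => k0.
rewrite !inE /depth hb ha.
have -> : (pos b).1 = b.1.+1%:Z by [].
move: k0 ta tb; move: (twos al _) (twos be _) (pos b).2 => ta tb p k0 ta0 tbN.
apply: (iffP idP) => [/andP[na /and3P[p1 p2 p3]]|[c pE]].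
  have na' : 2 * ta - b.1.+1%:Z < p + 1.
    by rewrite ltNge; apply: contra na => le1; rewrite p1 p2 le1.
  by move: p2 => /dvdzP[z zE]; split; lia.
apply/andP; split; last apply/and3P; first by apply/and3P=> -[]; lia.
split; [lia | | lia].
by apply/dvdzP; exists (tb - 1 - ((2 * tb - b.1.+1%:Z - 1 - p) %/ 2)%Z); lia.
Qed.

Lemma region_box (u : 'I_N) (c : int) : 0 <= c < kappa u.+1 ->
  exists b, [/\ b \in reg, b.1 = u & depth b = c].
Proof.
move=> cu; have uN : (u.+1 <= N)%N := ltn_ord u.
have hb := height_twos be uN; have tb := twos_le be uN; have ta := twos_ge0 al u.+1.
pose y : int := height be u.+1 - 1 - 2 * c.
have lt : (`|(y + N%:Z)%R| < N.*2.+1)%N by move: cu; rewrite /kappa /y hb; lia.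
have yE : (pos (u, Ordinal lt)).2 = y.
  by move: cu; rewrite /pos /= /kappa /y hb; lia.
exists (u, Ordinal lt); have d : depth (u, Ordinal lt) = c by apply: depth_unique.
by split=> //; apply/regionP; rewrite d yE.
Qed.

Lemma region_eq b b' : b \in reg -> b' \in reg ->
  b.1 = b'.1 :> nat -> depth b = depth b' -> b = b'.
Proof.
move=> /regionP[_ e] /regionP[_ e'] u d; apply: box_eq => //.
by rewrite e e' u d.
Qed.

Lemma region_above b : b \in reg -> 0 < depth b ->
  exists b', [/\ b' \in reg, b'.1 = b.1, depth b' = depth b - 1
               & pos b' \in neighbours (pos b)].
Proof.
move=> br d0; have /regionP[db pb] := br.
have [|b' [b'r u' d']] := @region_box b.1 (depth b - 1); first by lia.
exists b'; split=> //; have /regionP[_ pb'] := b'r.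
rewrite !inE; apply/orP; left; apply/eqP.
by rewrite [LHS]surjective_pairing pb' pb d' /= u'; congr (_, _); lia.
Qed.

(** At equal depth the boxes follow the step of [be] between the two columns: after an up step the
    right box is NE of the left one, after a down step the left box is NW of the right one. *)
Lemma region_side b b' : b \in reg -> b' \in reg ->
  b'.1 = b.1.+1 :> nat -> depth b = depth b' ->
  if be b'.1 then pos b' \in neighbours (pos b) else pos b \in neighbours (pos b').
Proof.
move=> /regionP[_ e] /regionP[_ e'] u d.
have := heightS be b'.1; rewrite /step u => h.
by case: ifP h => _ h; rewrite !inE; apply/orP; right; apply/orP; [right|left];
  apply/eqP; rewrite [LHS]surjective_pairing; (congr (_, _);
    [by rewrite /= u; lia | by move: h; rewrite e e' d u; lia]).
Qed.

End Depth.

Ltac clear_lia :=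
  repeat match goal with
  | H : is_true (_ \in _) |- _ => clear H
  | H : is_true (leB _ _) |- _ => clear H
  | H : is_true (ballot_strip _ _ _) |- _ => clear H
  | H : forall _, _ |- _ => clear H
  end; lia.

Section Mate.
Variables (N : nat) (b : word N).
Implicit Types x y : 'I_N.

(** The value [N] for an unpaired 2 lets one interval of columns, from [x] up to but excluding
    [mate x], describe both kinds of strips. *)
Definition mate x : nat :=
  if [pick q in pairs b | q.1 == x] is Some q then q.2 : nat else N.

Lemma mate_pair x y : (x, y) \in (pairing b).1 -> mate x = y.
Proof.
move=> qs; rewrite /mate; case: pickP => [q /andP[]|/(_ (x, y))]; last first.
  by rewrite inE qs eqxx.
rewrite inE => q's /eqP qx; congr nat_of_ord.
by rewrite (pairing_inj q's qs (i := x)) ?inE ?qx ?eqxx.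
Qed.

Lemma mate_unpaired x : x \in unpaired2_seq b -> mate x = N.
Proof.
rewrite mem_filter => /andP[_ xr]; rewrite /mate; case: pickP => // q /andP[].
rewrite inE => qs /eqP qx; have := pairing_rest_disjoint qs (i := x).
by rewrite xr inE qx eqxx => /(_ isT).
Qed.

Variant mate_spec x : nat -> Prop :=
  | MatePair y of (x, y) \in (pairing b).1 & (x < y)%N : mate_spec x y
  | MateUnpaired of x \in unpaired2_seq b : mate_spec x N.

Lemma mateP x : b x -> mate_spec x (mate x).
Proof.
move=> /first_or_unpaired[xu|[y qs]]; first by rewrite mate_unpaired //; constructor.
by rewrite (mate_pair qs); constructor=> //; have [] := pair_height qs.
Qed.

Lemma mate_gt x : b x -> (x < mate x <= N)%N.
Proof.
by case/mateP=> [y _ ->|_]; [exact: ltnW | rewrite ltn_ord leqnn].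
Qed.

End Mate.

Section Configurations.
Variables (N : nat) (al be : word N).
Hypothesis le : leB al be.
Notation box := ('I_N * 'I_(N.*2.+1))%type.
Notation reg := (region al be).
Notation kappa := (kappa al be).
Notation depth := (depth be).
Implicit Types (b : box) (D : {set box}) (x y : 'I_N).

(** The depth is that of the lowest box in the column of [x], which for [x] in [starts] is absent
    from the column before. *)
Definition strip x : {set box} :=
  [set b in reg | (x <= b.1 < mate be x)%N && (depth b == kappa x.+1 - 1)].

Lemma strip_mem x b : b \in strip x ->
  [/\ b \in reg, (x <= b.1 < mate be x)%N & depth b = kappa x.+1 - 1].
Proof. by rewrite inE => /and3P[? ? /eqP]. Qed.

Definition starts : {set 'I_N} := [set x | be x && ~~ al x].

(* The consequences of membership in [ConfII] from which all the rest follows;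
   [conf_above] is Rule IIa read at the boxes just above those of [D]. *)
Record configuration (Pi : {set {set box}}) : Prop := Configuration {
  conf_ballot : forall D, D \in Pi -> exists l l' (x : nat) f,
    ballot_param l l' D x f /\
    ((0 < l')%N -> forall b, b \in D ->
       (forall b', b' \in D -> (pos b').1 <= (pos b).1) -> anchor b);
  conf_sub : forall D b, D \in Pi -> b \in D -> b \in reg;
  conf_cover : forall b, b \in reg -> exists2 D, D \in Pi & b \in D;
  conf_above : forall D D' b b', D \in Pi -> D' \in Pi -> D != D' ->
    b \in D -> b' \in D' -> pos b' \in neighbours (pos b) ->
    forall b2, b2 \in D -> exists b3, [/\ b3 \in D \/ b3 \in D', b3 \in reg,
      b3.1 = b2.1 :> nat & depth b3 = depth b2 - 1] }.

Lemma ConfII_configuration Pi : Pi \in ConfII al be -> configuration Pi.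
Proof.
rewrite inE => /and4P[part /forallP sl /forallP r0 /forallP r2].
have sub D b : D \in Pi -> b \in D -> b \in reg.
  by move=> DP bD; rewrite -(cover_partition part); apply/bigcupP; exists D.
split=> // [D DP|b|D D' b b' DP D'P ne bD b'D' nb b2 b2D].
- have := sl D; rewrite DP /strip_length; case: pickP => // -[l l'] /= bal _.
  have [x [f bp]] := (ballot_stripP _ _ _).1 bal.
  exists l, l', x, f; split=> // l'0 b bD bmax.
  have := r0 D; rewrite DP => /forallP/(_ (l, l')).
  rewrite /= bal l'0 => /forallP/(_ b); rewrite bD /= => /implyP; apply.
  by apply/forallP => b'; apply/implyP; exact: bmax.
- by rewrite -(cover_partition part) => /bigcupP[D DP bD]; exists D.
have := r2 D; rewrite DP => /forallP/(_ D'); rewrite D'P ne /= => /implyP r2D.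
have /r2D/forallP/(_ b2) : [exists b in D, exists b' in D', pos b' \in neighbours (pos b)].
  by apply/existsP; exists b; rewrite bD; apply/existsP; exists b'; rewrite b'D'.
rewrite b2D implyTb => /and4P[+ _ _ _].
rewrite lez_nat ltn_ord => /existsP[b3 /andP[b3in /eqP p3]].
exists b3; have b3u : b3.1 = b2.1 :> nat by case: p3.
have b3or : b3 \in D \/ b3 \in D' by apply/orP; move: b3in; rewrite inE.
have b3r : b3 \in reg by case: b3or; exact: sub.
split=> //; apply: depth_unique; rewrite b3u.
have /(regionP le)[_ e] := sub _ _ DP b2D.
have -> : (pos b3).2 = (pos b2).2 + 2 by rewrite p3.
by rewrite e; clear; lia.
Qed.

(** * A configuration is determined, and forces [al] to be a flip of [be] *)

Section Necessary.
Variable Pi : {set {set box}}.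
Hypothesis confPi : configuration Pi.

Lemma conf_column D b b' : D \in Pi -> b \in D -> b' \in D -> b.1 = b'.1 :> nat -> b = b'.
Proof. by move=> /(conf_ballot confPi)[l [l' [x [f [bp _]]]]]; exact: ballot_param_inj bp. Qed.

(** Once one box of [D] has a box of another strip just above it, Rule IIa puts a box above every
    box of [D], and it lies in that strip because [D] has one box per column. So unequal depths in a
    strip stay unequal one level up, until one of them would become negative. *)
Lemma conf_depth D b b2 : D \in Pi -> b \in D -> b2 \in D -> depth b2 = depth b.
Proof.
have ge0 b1 : b1 \in reg -> 0 <= depth b1 by case/(regionP le)=> /andP[].
have up D1 b1 : D1 \in Pi -> b1 \in D1 -> 0 < depth b1 -> exists D' b',
    [/\ D' \in Pi, b' \in D', depth b' = depth b1 - 1 & forall b2, b2 \in D1 ->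
      exists b3, [/\ b3 \in D', b3 \in reg & depth b3 = depth b2 - 1]].
  move=> DP bD d0; have [b' [b'r u' d' nb]] := region_above le (conf_sub confPi DP bD) d0.
  have [D' D'P b'D'] := conf_cover confPi b'r; exists D', b'; split=> // b3 b3D.
  have ne : D1 != D'.
    apply/eqP => e; move: d'; rewrite (conf_column DP _ bD (b := b')) ?u' ?e //; clear; lia.
  have [b4 [b4D b4r u4 d4]] := conf_above confPi DP D'P ne bD b'D' nb b3D.
  exists b4; split=> //; case: b4D => // b4D.
  by exfalso; move: d4; rewrite (conf_column DP b4D b3D u4); clear; lia.
move=> DP bD b2D; move: {2}`|depth b|%N (erefl `|depth b|%N) => n.
elim: n D b b2 DP bD b2D => [|n IH] D1 b b2' DP bD b2D db.
  have db0 : depth b = 0 by clear_lia.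
  have := ge0 _ (conf_sub confPi DP b2D); rewrite le_eqVlt => /predU1P[<- //|d0].
  have [D' [b' [_ _ _ all3]]] := up _ _ DP b2D d0.
  by have [b3 [_ /ge0 + d3]] := all3 _ bD; rewrite d3 db0.
have := ge0 _ (conf_sub confPi DP bD) => b0.
have [|D' [b' [D'P b'D' d' all3]]] := up _ _ DP bD; first by clear_lia.
have [b3 [b3D' _ d3]] := all3 _ b2D.
by have := IH _ _ _ D'P b'D' b3D'; clear_lia.
Qed.

(** One of the two boxes is a neighbour of the other. For distinct strips Rule IIa would yield a box
    one level higher in [D] or [D'], but both strips have constant depth. *)
Lemma conf_maximal D D' b b' : D \in Pi -> D' \in Pi -> b \in D -> b' \in D' ->
  b'.1 = b.1.+1 :> nat -> depth b = depth b' -> D = D'.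
Proof.
move=> DP D'P bD b'D' u d; apply/eqP; apply: contraT => ne.
have := region_side le (conf_sub confPi DP bD) (conf_sub confPi D'P b'D') u d.
have no b1 b3 : b1 \in D \/ b1 \in D' -> b3 \in D \/ b3 \in D' ->
    depth b3 = depth b1 - 1 -> False.
  have dD b1' : b1' \in D \/ b1' \in D' -> depth b1' = depth b.
    by case=> h; [exact: conf_depth h | rewrite d; exact: conf_depth h].
  by move=> /dD -> /dD ->; clear_lia.
case: ifP => _ nb.
  have [b3 [b3D _ _ d3]] := conf_above confPi DP D'P ne bD b'D' nb bD.
  by case: (no _ _ (or_introl bD) b3D d3).
rewrite eq_sym in ne.
have [b3 [b3D _ _ d3]] := conf_above confPi D'P DP ne b'D' bD nb b'D'.
by case: (no b' b3 (or_intror b'D') _ d3); case: b3D; [right | left].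
Qed.

Lemma conf_strip D : D \in Pi -> exists x, [/\ x \in starts, D = strip x,
  forall y, (x <= y < mate be x)%N -> exists2 b, b \in D & b.1 = y
  & forall y, mate be x = y :> nat -> al y].
Proof.
move=> DP; have [l [l' [x0 [f [bp r0]]]]] := conf_ballot confPi DP.
case: (bp) => col mem stp mn en; set n := (l.*2 + l')%N in col mem stp mn en.
have fD k : (k <= n)%N -> f k \in D by move=> kn; apply/mem; exists k.
pose c := depth (f 0).
have fc k : (k <= n)%N -> depth (f k) = c.
  by move=> kn; exact: (conf_depth DP (fD 0 (leq0n n)) (fD _ kn)).
have fr k : (k <= n)%N -> f k \in reg.
  by move=> kn; exact: (conf_sub confPi DP (fD _ kn)).
have nN : (x0 + n < N)%N by rewrite -col.
have x0N : (x0 < N)%N by rewrite (leq_ltn_trans _ nN) ?leq_addr.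
have [x xE] : exists x, x = x0 :> nat by exists (Ordinal x0N).
subst x0.
have kap k : (k <= n)%N -> 0 <= c < kappa (x + k).+1.
  by move=> kn; have /(regionP le)[] := fr k kn; rewrite fc // col.
have c0 : 0 <= c by have /andP[] := kap 0 isT.
(* A box of depth [c] in the column before would belong to [D] by maximality. The same argument at
   the right end gives [key] below. *)
have k0 : kappa x <= c.
  case: (posnP x) => [->|x_gt0]; first by rewrite kappa0.
  rewrite leNgt; apply/negP => ck.
  have x1N : (x.-1 < N)%N by rewrite prednK // ltnW // ltn_ord.
  have [|b [br u d]] := @region_box _ _ _ le (Ordinal x1N) c; first by rewrite c0 /= prednK.
  have [D' D'P bD'] := conf_cover confPi br.
  have : b \in D.
    rewrite -(conf_maximal D'P DP bD' (fD 0 isT)) ?d //.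
    by rewrite col // addn0 u /= prednK.
  by move=> /mem[k kn bE]; have := col k kn; rewrite -bE u /=; move: x_gt0 => /=; clear_lia.
have xs : x \in starts /\ kappa x.+1 = c + 1.
  have := kap 0 isT; rewrite addn0 => kx; have := kappaS al be x; rewrite inE.
  by case: (be x) (al x) => [] [] /=; clear_lia.
case: xs => xs kx; have [bx ax] : be x /\ ~~ al x by move: xs; rewrite inE => /andP[].
have hf k : (k <= n)%N -> (pos (f k)).2 = height be (x + k).+1 - 1 - 2 * c.
  by move=> kn; have /(regionP le)[_] := fr k kn; rewrite fc // col.
have hx : height be x.+1 = height be x + 1 by rewrite heightS /step bx.
(* At constant depth the strip is a translate of the path [be], so the ballot condition becomes a
   bound on heights. *)
have hmin' k : (x < k <= (x + n).+1)%N -> height be x + 1 <= height be k.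
  case: k => // k kn; have kn' : (k - x <= n)%N by clear_lia.
  have xk : (x + (k - x))%N = k by clear_lia.
  by have := mn _ kn'; rewrite !hf // addn0 xk hx; clear_lia.
have mE : mate be x = (x + n).+1 /\ (forall y, mate be x = y :> nat -> al y).
  move: nN; rewrite leq_eqVlt => /predU1P[eN|ltN].
    have xu : x \in unpaired2_seq be.
      by apply: mem_unpaired2 => // k kN; apply: hmin'; rewrite /= eN.
    rewrite (mate_unpaired xu) /= eN; split=> // y yE.
    by have := ltn_ord y; rewrite -yE ltnn.
  have [y yE] : exists y, y = (x + n).+1 :> nat by exists (Ordinal ltN).
  have key : kappa y.+1 <= c.
    rewrite leNgt; apply/negP => ck.
    have [|b [br u d]] := @region_box _ _ _ le y c; first by rewrite c0.
    have [D' D'P bD'] := conf_cover confPi br.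
    have : b \in D.
      rewrite (conf_maximal DP D'P (fD n (leqnn n)) bD') ?d ?fc //.
      by rewrite col // u yE.
    by move=> /mem[k kn bE]; have := col k kn; rewrite -bE u yE; clear_lia.
  have [bNy ay] : ~~ be y /\ al y.
    by have := kap n (leqnn n); have := kappaS al be y; rewrite -yE;
       case: (be y) (al y) => [] [] /=; clear_lia.
  (* By Rule 0 a positive [l'] would put the last box in the anchor column, but the column of [y]
     still follows. *)
  have l'0 : l' = 0%N.
    apply/eqP; rewrite -leqn0 leqNgt; apply/negP => l'0.
    have := r0 l'0 (f n) (fD n (leqnn n)).
    rewrite /anchor /= col // => H; move: ltN.
    have : (x + n).+1%:Z == N%:Z.
      apply: H => b' /mem[k kn ->]; rewrite lez_nat ltnS /= col //; clear_lia.
    by rewrite eqz_nat => /eqP->; rewrite ltnn.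
  have hy : height be y.+1 = height be x.
    rewrite heightS /step (negPf bNy) /=; move: en.
    by rewrite yE !hf // l'0 addn0 hx; clear_lia.
  have qs : (x, y) \in (pairing be).1.
    by apply: mem_pairing => //; [rewrite yE ltnS leq_addr | rewrite yE].
  by rewrite (mate_pair qs); split=> // z /val_inj <-.
case: mE => mE mal; exists x; split=> //.
  apply/setP => b; rewrite inE; apply/idP/and3P => [bD|[br xb db]].
    have := bD; move=> /mem[k kn bE]; rewrite mE kx.
    rewrite bE fr // fc // col //=; split=> //; first by clear_lia.
    by apply/eqP; clear_lia.
  have kn : (b.1 - x <= n)%N by move: xb; rewrite mE; clear_lia.
  have -> : b = f (b.1 - x)%N.
    apply: (region_eq le br (fr _ kn)); first by rewrite col //=; move: xb => /=; clear_lia.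
    by rewrite fc // (eqP db) kx; clear_lia.
  exact: fD.
move=> y; rewrite mE => xy; have kn : (y - x <= n)%N by clear_lia.
exists (f (y - x)%N); first exact: fD.
by apply/val_inj; rewrite /= col //=; move: xy => /=; clear_lia.
Qed.

(** The column sizes drop at [y], so the strip through the lowest box of the preceding column cannot
    continue and its mate is [y]. *)
Lemma conf_end y : ~~ be y -> al y -> exists x,
  [/\ x \in starts, (x, y) \in (pairing be).1 & strip x \in Pi].
Proof.
move=> bNy ay; have ky := kappaS al be y; rewrite (negPf bNy) ay /= in ky.
have ky0 := kappa_ge0 le (ltn_ord y).
have y0 : (0 < y)%N.
  by rewrite lt0n; apply/eqP => e; move: ky; rewrite e kappa0 -e; clear_lia.
have y1N : (y.-1 < N)%N by rewrite prednK // ltnW // ltn_ord.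
have [|b [br u d]] := @region_box _ _ _ le (Ordinal y1N) (kappa y - 1).
  by rewrite /= prednK //; clear_lia.
have [D DP bD] := conf_cover confPi br; have [x [xs DE cov mal]] := conf_strip DP.
exists x; rewrite -DE; split=> //.
have := bD; rewrite {1}DE inE br u /= => /andP[/andP[xy ym] _].
have bx : be x by move: xs; rewrite inE => /andP[].
have my : mate be x = y.
  apply/eqP; rewrite eqn_leq; apply/andP; split; last by rewrite -(prednK y0).
  rewrite leqNgt; apply/negP => ylt.
  have [|b' b'D u'] := cov y; first by rewrite ylt andbT (leq_trans xy) ?leq_pred.
  have /(regionP le)[] := conf_sub confPi DP b'D.
  by rewrite u' (conf_depth DP bD b'D) d; clear_lia.
case: (mateP bx) my => [y' qs _ /val_inj <- //|_ yN].
by have := ltn_ord y; rewrite -yN ltnn.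
Qed.

(** The lowest box in the column of [x] has no box of its depth on its left, so the strip through it
    starts at [x]. *)
Lemma conf_start x : x \in starts -> strip x \in Pi.
Proof.
move=> xs; have := xs; rewrite inE => /andP[bx /negPf ax].
have kx := kappaS al be x; rewrite bx ax /= in kx.
have kx0 := kappa_ge0 le (ltnW (ltn_ord x)).
have [|b [br u d]] := @region_box _ _ _ le x (kappa x.+1 - 1); first by clear_lia.
have [D DP bD] := conf_cover confPi br; have [z [zs DE cov mal]] := conf_strip DP.
have := bD; rewrite {1}DE inE br u /= => /andP[/andP[zx xm] _].
suff -> : x = z by rewrite -DE.
apply/val_inj/eqP; rewrite eqn_leq zx andbT leqNgt; apply/negP => /= zltx.
have x0 : (0 < x)%N by apply: leq_ltn_trans zltx.
have x1N : (x.-1 < N)%N by rewrite prednK // ltnW // ltn_ord.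
have [|b' b'D u'] := cov (Ordinal x1N); first by rewrite /=; clear_lia.
have /(regionP le)[] := conf_sub confPi DP b'D.
by rewrite u' (conf_depth DP bD b'D) d /= prednK //; clear_lia.
Qed.

Lemma conf_eq : Pi = [set strip x | x in starts].
Proof.
apply/setP => D; apply/idP/imsetP => [/conf_strip[x [xs -> _ _]]|[x xs ->]].
  by exists x.
exact: conf_start.
Qed.

Lemma conf_compatible : compatible al be.
Proof.
apply/andP; split; apply/allP.
  move=> [x y] qs /=; have /andP[/= bx bNy] := pairing_letters qs.
  case ay: (al y).
    have [x' [xs qs' _]] := conf_end bNy ay.
    have [<-] : (x', y) = (x, y).
      by apply: (pairing_inj qs' qs (i := y)); rewrite !inE eqxx orbT.
    by move: xs; rewrite inE => /andP[_ /negPf->].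
  case ax: (al x) => //.
  (* Both letters of the pair are 1's in [al]: the strip started at [x] stops at its mate [y], where
     [al] would need a 2. *)
  have xs : x \in starts by rewrite inE bx ax.
  have [z [zs zE cov mal]] := conf_strip (conf_start xs).
  suff zx : z = x by move: (mal y); rewrite zx (mate_pair qs) ay => /(_ erefl).
  have [b bS bx'] : exists2 b, b \in strip x & b.1 = x.
    have kx := kappaS al be x; rewrite bx ax /= in kx.
    have kx0 := kappa_ge0 le (ltnW (ltn_ord x)).
    have [|b [br u d]] := @region_box _ _ _ le x (kappa x.+1 - 1); first by clear_lia.
    by exists b; rewrite // inE br u d eqxx leqnn /= andbT; have /andP[] := mate_gt bx.
  have bz : be z by move: zs; rewrite inE => /andP[].
  have [|b' b'S bz'] := cov z; first by rewrite leqnn; have /andP[] := mate_gt bz.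
  apply/val_inj/eqP; rewrite /= eqn_leq; apply/andP; split.
    by move: bS; rewrite zE inE bx' => /andP[_ /andP[/andP[]]].
  by move: b'S; rewrite inE bz' => /andP[_ /andP[/andP[]]].
move=> i ir; case bi: (be i) => //=; apply/negP => ai.
have [|x [_ qs _]] := conf_end _ ai; first by rewrite bi.
by have := pairing_rest_disjoint qs (i := i); rewrite ir !inE eqxx orbT => /(_ isT).
Qed.

End Necessary.


(** * For a flip of [be], the forced strips do form a configuration *)

Section Sufficient.
Hypothesis comp : compatible al be.

Let g (i : 'I_N) : int := (be i)%:R - (al i)%:R.

Let kappa_psum k : kappa k = psum g (enum 'I_N) k.
Proof. by rewrite /kappa /psum sumrB. Qed.

Let g_pairs : {in (pairing be).1, forall q, 0 <= g q.1 /\ g q.1 + g q.2 = 0}.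
Proof.
move=> q qs; rewrite /g; have /andP[/allP/(_ _ qs) + _] := comp.
have /andP[-> /negPf->] := pairing_letters qs.
by case: (al q.1) (al q.2) => [] [].
Qed.

Let g_rest : {in (pairing be).2, forall i, 0 <= g i}.
Proof.
move=> i ir; rewrite /g; have /andP[_ /allP/(_ _ ir)] := comp.
by case: (be i) (al i) => [] [].
Qed.

Lemma starts_letters x : x \in starts -> be x /\ al x = false.
Proof. by rewrite inE => /andP[-> /negPf]. Qed.

Lemma kappa_start x : x \in starts -> kappa x.+1 = kappa x + 1.
Proof. by move=> /starts_letters[bx ax]; rewrite kappaS bx ax subr0. Qed.

(** Compatibility lets the prefix sum lemmas apply to [be - al] as they do to heights, so the
    columns stay long enough for the strip to reach its mate. *)
Lemma kappa_mate x k : x \in starts -> (x < k <= mate be x)%N -> kappa x.+1 <= kappa k.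
Proof.
move=> xs; rewrite (kappa_start xs); have [bx ax] := starts_letters xs.
have gx : g x = 1 by rewrite /g bx ax subr0.
case: (mateP bx) => [y qs _|xu] xk; rewrite !kappa_psum.
  by have [_ + _] := psum_pair g_pairs qs; rewrite /= gx; apply.
have xr : x \in (pairing be).2 by move: xu; rewrite mem_filter => /andP[].
rewrite -gx; apply: (psum_unpaired g_pairs xr); last by case/andP: xk.
by move=> i ir _; exact: g_rest.
Qed.

Lemma kappa_mateS x y : x \in starts -> mate be x = y :> nat ->
  [/\ kappa y = kappa x.+1, kappa y.+1 = kappa x & ~~ be y].
Proof.
move=> xs; rewrite (kappa_start xs); have [bx ax] := starts_letters xs.
case: (mateP bx) => [y' qs _ /val_inj <-|_ yE]; last first.
  by have := ltn_ord y; rewrite -yE ltnn.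
have [_ _] := psum_pair g_pairs qs; rewrite -!kappa_psum /= => ky.
have /andP[_ /= bNy] := pairing_letters qs; split=> //.
have := kappaS al be y'; rewrite ky (negPf bNy).
have [_] := g_pairs qs; rewrite /g /= bx ax (negPf bNy).
by case: (al y') => //= _; clear; lia.
Qed.

Lemma mate_height x k : be x -> (x < k <= mate be x)%N -> height be x.+1 <= height be k.
Proof.
move=> bx; rewrite heightS /step bx; case: (mateP bx) => [y qs _|xu] xk.
  by have [_ + _] := pair_height qs; apply.
by apply: unpaired_height => //; case/andP: xk.
Qed.

Lemma strip_box x k : x \in starts -> (x <= k < mate be x)%N ->
  exists2 b, b \in strip x & b.1 = k :> nat.
Proof.
move=> xs xk; have [bx _] := starts_letters xs.
have kN : (k < N)%N.
  by case/andP: xk => _ km; apply: leq_trans km _; have /andP[] := mate_gt bx.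
have k0 := kappa_ge0 le (ltnW (ltn_ord x)).
have kx := kappa_start xs; have km := @kappa_mate x k.+1 xs.
have [|b [br u d]] := @region_box _ _ _ le (Ordinal kN) (kappa x.+1 - 1).
  have {km} := km xk; move: kx k0 => /=; clear; lia.
by exists b; [rewrite inE br u d eqxx andbT | rewrite u].
Qed.

Lemma strip_unique x b b' : b \in strip x -> b' \in strip x -> b.1 = b'.1 :> nat -> b = b'.
Proof.
rewrite [b \in _]inE [b' \in _]inE => /and3P[br _ /eqP d] /and3P[b'r _ /eqP d'] u.
by apply: (region_eq le br b'r u); rewrite d d'.
Qed.

Lemma strip_pos x b : b \in strip x ->
  (pos b).2 = height be b.1.+1 - 1 - 2 * (kappa x.+1 - 1).
Proof. by rewrite inE => /and3P[/(regionP le)[_ ->] _ /eqP->]. Qed.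

(** If [y] starts before the strip of [x] ends, its column has already grown beyond the level of
    that strip, so the strip of [y] is strictly deeper. *)
Lemma strip_disjoint x y b : x \in starts -> y \in starts ->
  b \in strip x -> b \in strip y -> x = y.
Proof.
have H x' y' : x' \in starts -> y' \in starts -> b \in strip x' -> b \in strip y' ->
    (x' < y')%N -> False.
  move=> xs ys /strip_mem[_ /andP[_ bm] d] /strip_mem[_ /andP[yb _] d'].
  move=> xy; have := @kappa_mate x' y' xs; rewrite xy (leq_trans yb (ltnW bm)).
  by move=> /(_ isT); have := kappa_start ys; move: d; rewrite d'; clear; lia.
move=> xs ys bx by'; apply/val_inj; case: (ltngtP x y) => //= lt.
- by case: (H x y).
- by case: (H y x).
Qed.

Lemma strip_cover b : b \in reg -> exists2 x, x \in starts & b \in strip x.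
Proof.
move=> br; have /(regionP le)[/andP[d0 dk] _] := br.
(* The strip through [b] starts at the last position up to [b] whose column size is at most the
   depth of [b]; position 0 always qualifies. *)
have [|i|p /andP[pu pk] pmax] :=
    @ex_maxnP (fun p => (p <= b.1)%N && (kappa p <= depth b)) b.1.
- by exists 0%N; rewrite kappa0.
- by case/andP.
have pN : (p < N)%N by apply: leq_ltn_trans pu (ltn_ord b.1).
pose x := Ordinal pN.
have gtp k : (p < k <= b.1.+1)%N -> depth b < kappa k.
  case/andP=> pk'; rewrite leq_eqVlt => /predU1P[->//|kb].
  rewrite ltNge; apply/negP => kk; have := pmax k.
  by rewrite -ltnS kb kk leqNgt pk' => /(_ isT).
have kx : kappa x.+1 = depth b + 1 /\ x \in starts.
  have := gtp p.+1; rewrite leqnn ltnS pu => /(_ isT).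
  have := kappaS al be x; rewrite inE; move: pk => /=; clear.
  by case: (be x) (al x) => [] [] /=; lia.
case: kx => kx xs; exists x => //; have [bx _] := starts_letters xs.
rewrite inE br /= pu kx addrK eqxx andbT ltnNge; apply/negP => mb.
have mN : (mate be x < N)%N by apply: leq_ltn_trans mb (ltn_ord b.1).
have [_ ky _] := @kappa_mateS x (Ordinal mN) xs erefl.
have := gtp (mate be x).+1; have /andP[xm _] := mate_gt bx.
by rewrite !ltnS mb (ltnW xm) => /(_ isT); rewrite [kappa _]ky ltNge pk.
Qed.

Lemma strip_ballot l l' x : x \in starts ->
  ballot_strip l l' (strip x) <->
  (x + (l.*2 + l')).+1 = mate be x /\ height be (mate be x) = height be x.+1 + l'%:Z.
Proof.
move=> xs; have [bx _] := starts_letters xs; have /andP[xm mN] := mate_gt bx.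
rewrite ballot_stripP; split.
  case=> x0 [f [col mem stp mn en]].
  set n := (l.*2 + l')%N in col mem stp mn en *.
  have fS k : (k <= n)%N -> f k \in strip x by move=> kn; apply/mem; exists k.
  have fb k : (k <= n)%N -> (x <= x0 + k < mate be x)%N.
    by move=> kn; have := fS k kn; rewrite inE col // => /and3P[].
  have xx0 : x0 = x.
    have := fb 0 isT; have [|b /mem[k kn ->]] := @strip_box x x xs.
      by rewrite leqnn.
    by rewrite col //; clear; lia.
  have xn : (x0 + n).+1 = mate be x.
    have := fb n (leqnn n); have [|b /mem[k kn ->]] := @strip_box x (mate be x).-1 xs.
      by move: xm; clear; lia.
    by rewrite col //; move: xm kn; clear; lia.
  split; first by rewrite -xx0.
  move: en; rewrite (strip_pos (fS n (leqnn n))) (strip_pos (fS 0 isT)) !col //.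
  by rewrite addn0 xn xx0; clear; lia.
case=> xn hm; set n := (l.*2 + l')%N in xn *.
have [b0 _ _] := @strip_box x x xs ltac:(by rewrite leqnn).
pose f k := odflt b0 [pick b in strip x | b.1 == (x + k)%N :> nat].
have fP k : (k <= n)%N -> f k \in strip x /\ (f k).1 = (x + k)%N :> nat.
  move=> kn; rewrite /f; case: pickP => [b /andP[bs /eqP]//|no].
  have [|b bs bk] := @strip_box x (x + k)%N xs.
    by rewrite leq_addr -xn ltnS leq_add2l.
  by have := no b; rewrite bs bk eqxx.
have pf k : (k <= n)%N ->
    (pos (f k)).2 = height be (x + k).+1 - 1 - 2 * (kappa x.+1 - 1).
  by move=> kn; have [fs fu] := fP k kn; rewrite (strip_pos fs) fu.
exists x, f; split.
- by move=> k /fP[].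
- move=> b; split=> [bs|[k /fP[fs _] ->//]].
  have xb : (x <= b.1 < mate be x)%N by move: bs; rewrite inE => /and3P[].
  exists (b.1 - x)%N; first by move: xb; rewrite -xn; clear; lia.
  have bn : (b.1 - x <= n)%N by move: xb; rewrite -xn; clear; lia.
  have [fs fu] := fP _ bn; apply: (strip_unique bs fs).
  by rewrite fu; case/andP: xb => xb _; rewrite subnKC.
- move=> k kn; rewrite !pf // ?(ltnW kn) //.
  have kN : ((x + k).+1 < N)%N by apply: leq_trans mN; rewrite -xn ltnS -addnS leq_add2l.
  have := heightS be (Ordinal kN); rewrite /step addnS /= => ->.
  by case: (be _); [left | right]; clear; lia.
- move=> k kn; rewrite !pf // addn0; have := @mate_height x (x + k).+1 bx.
  by rewrite ltnS leq_addr -xn ltnS leq_add2l kn => /(_ isT); clear; lia.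
- by rewrite !pf // xn addn0 hm; clear; lia.
Qed.

Lemma strip_inj : {in starts &, injective strip}.
Proof.
move=> x y xs ys e; have [bx _] := starts_letters xs.
have [|b bs _] := @strip_box x x xs.
  by rewrite leqnn; have /andP[] := mate_gt bx.
by apply: (strip_disjoint xs ys bs); rewrite -e.
Qed.


Lemma strip_lengthP x : x \in starts -> exists l l' : 'I_N,
  [/\ strip_length (strip x) = Some (l, l'), (x + (l.*2 + l')).+1 = mate be x
    & height be (mate be x) = height be x.+1 + l'%:Z].
Proof.
move=> xs; have [bx _] := starts_letters xs; have /andP[xm mN] := mate_gt bx.
rewrite /strip_length; case: pickP => [[l l'] /= /(strip_ballot _ _ xs)[]|no].
  by exists l, l'.
have hx := height_twos be (leq_trans xm mN); have hm := height_twos be mN.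
have td := @twos_diff _ be x.+1 (mate be x); rewrite xm mN in td.
have := @mate_height x (mate be x) bx; rewrite xm leqnn => /(_ isT) hge.
(* [l] counts the 1's of [be] strictly between [x] and its mate, and [l'] the excess of 2's over 1's
   there. *)
pose l := `|((mate be x)%:Z - x.+1%:Z - (twos be (mate be x) - twos be x.+1))%R|%N.
pose l' := `|(height be (mate be x) - height be x.+1)%R|%N.
have e1 : (x + (l.*2 + l')).+1 = mate be x.
  by have := td isT; move: hge; rewrite /l /l' hx hm; move: xm; clear; lia.
have lN : (l < N)%N by apply: leq_trans mN; rewrite -e1 -addnn; clear; lia.
have l'N : (l' < N)%N by apply: leq_trans mN; rewrite -e1; clear; lia.
have bal : ballot_strip l l' (strip x).
  apply/(strip_ballot _ _ xs); split=> //.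
  by rewrite /l'; move: hge; clear; lia.
by have := no (Ordinal lN, Ordinal l'N); rewrite /= bal.
Qed.

Lemma height_pair x y : x \in starts -> (x, y) \in (pairing be).1 ->
  height be y = height be x.+1.
Proof.
move=> xs qs; have [bx _] := starts_letters xs.
have [_ _ /=] := pair_height qs; have /andP[_ /= /negPf bNy] := pairing_letters qs.
by rewrite !heightS /step bx bNy; clear; lia.
Qed.

Definition strips : {set {set box}} := [set strip x | x in starts].

Lemma strips_partition : partition strips reg.
Proof.
apply/and3P; split.
- apply/eqP/setP => b; apply/bigcupP/idP => [[D /imsetP[x xs ->]]|br].
    by rewrite inE => /andP[].
  by have [x xs bx] := strip_cover br; exists (strip x) => //; apply: imset_f.
- apply/trivIsetP => _ _ /imsetP[x xs ->] /imsetP[y ys ->] ne.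
  apply/pred0P => b /=; apply/negP => /andP[bx by']; case/eqP: ne.
  by rewrite (strip_disjoint xs ys bx by').
- apply/negP => /imsetP[x xs e]; have [bx _] := starts_letters xs.
  have [|b + _] := @strip_box x x xs; last by rewrite -e inE.
  by rewrite leqnn; have /andP[] := mate_gt bx.
Qed.

Lemma strips_rule0 : rule0 strips.
Proof.
apply/forallP => D; apply/implyP => /imsetP[x xs ->].
have [bx _] := starts_letters xs.
apply/forallP => -[l l'] /=; apply/implyP => /andP[bal l'0].
have [xn hm] := (strip_ballot _ _ xs).1 bal.
apply/forallP => b; apply/implyP => bS; apply/implyP => /forallP bmax.
case: (mateP bx) hm xn (@strip_box x (mate be x).-1 xs) => [y qs _|_] hm xn sb.
  by move: hm l'0; rewrite (height_pair xs qs); clear; lia.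
have [|b' b'S u'] := sb; first by move: xn; clear; lia.
have := bmax b'; rewrite b'S /= lez_nat u' /anchor /= eqz_nat => bN.
by rewrite eqn_leq ltn_ord (leq_trans _ bN) // -xn.
Qed.

(** The columns next to both ends of a strip stop just above its level, so no box of the same depth
    adjoins it outside. *)
Lemma strip_block x b b' : x \in starts -> b \in strip x -> b' \in reg ->
    b'.1 = b.1.+1 :> nat \/ b.1 = b'.1.+1 :> nat -> depth b' = depth b ->
  b' \in strip x.
Proof.
move=> xs bS b'r u d; have [br /andP[xb bm] db] := strip_mem bS.
rewrite [b' \in _]inE b'r d db eqxx andbT /=.
have /(regionP le)[/andP[_ d'] _] := b'r; rewrite d db in d'.
have kx := kappa_start xs; have [bx _] := starts_letters xs.
apply/andP; split.
  rewrite leqNgt; apply/negP => b'x; have e : b'.1.+1 = x by case: u b'x; move: xb; clear; lia.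
  by move: d'; rewrite e kx; clear; lia.
rewrite ltnNge; apply/negP => mb; have e : mate be x = b'.1.
  by case: u mb; move: bm; clear; lia.
have [_ ky _] := kappa_mateS xs e.
by move: d'; rewrite ky kx; clear; lia.
Qed.

Lemma strips_ruleIIa : ruleIIa strips.
Proof.
apply/forallP => D; apply/implyP => /imsetP[x xs ->].
apply/forallP => D'; apply/implyP => /imsetP[x' xs' ->].
apply/implyP => /andP[ne /existsP[b /andP[bS /existsP[b' /andP[b'S nb]]]]].
have [bx ax] := starts_letters xs; have /andP[xm mN] := mate_gt bx.
have subr z a : a \in strip z -> a \in reg by case/strip_mem.
have br := subr _ _ bS; have b'r := subr _ _ b'S.
have notin a : a \in strip x -> a \in strip x' -> False.
  by move=> a1 a2; case/eqP: ne; rewrite (strip_disjoint xs xs' a1 a2).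
have dS a : a \in strip x -> depth a = kappa x.+1 - 1.
  by case/strip_mem.
have pE a : a \in reg -> (pos a).2 = height be a.1.+1 - 1 - 2 * depth a.
  by move=> /(regionP le)[].
pose c := kappa x.
have kx : kappa x.+1 = c + 1 := kappa_start xs.
have dx a : a \in strip x -> depth a = c by move=> /dS ->; rewrite kx addrK.
(* The neighbour that triggers the rule lies one level up: at equal depth, [strip_block] would put
   it in [strip x]. It is at most one column outside the range of the strip. *)
have d' : depth b' = c - 1 /\ (x <= b'.1.+1)%N && (b'.1 <= mate be x)%N.
  have xb : (x <= b.1 < mate be x)%N by have [] := strip_mem bS.
  have pb := pE _ br; have pb' := pE _ b'r; rewrite (dx _ bS) in pb.
  move: nb; rewrite !inE => /or3P[]/eqP e.
  - have u : b'.1 = b.1 :> nat by case: e.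
    have e2 : (pos b').2 = (pos b).2 + 2 by rewrite e.
    by move: e2 xb; rewrite pb pb' u; clear; lia.
  - have u : b.1 = b'.1.+1 :> nat.
      by have : (pos b').1 = (pos b).1 - 1 := congr1 fst e; rewrite /=; clear; lia.
    have e2 : (pos b').2 = (pos b).2 + 1 by rewrite e.
    have : depth b' <> c.
      move=> dc; apply: (notin b') => //.
      apply: (strip_block xs bS b'r); last by rewrite dc dx.
      by right.
    have := heightS be b.1; rewrite /step; move: e2 xb; rewrite pb pb' u.
    by case: (be b.1); clear; lia.
  - have u : b'.1 = b.1.+1 :> nat.
      by have : (pos b').1 = (pos b).1 + 1 := congr1 fst e; rewrite /=; clear; lia.
    have e2 : (pos b').2 = (pos b).2 + 1 by rewrite e.
    have : depth b' <> c.
      move=> dc; apply: (notin b') => //.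
      apply: (strip_block xs bS b'r); last by rewrite dc dx.
      by left.
    have := heightS be b'.1; rewrite /step; move: e2 xb; rewrite pb pb' u.
    by case: (be b'.1); clear; lia.
case: d' => d' xb'.
have c1 : 0 <= c - 1 by have /(regionP le)[/andP[]] := b'r; rewrite d'.
(* All columns from just left of the strip to just right of it reach depth [c - 1], so [strip x']
   can be followed from [b'] through all of them. *)
have kap k : (x <= k.+1)%N -> (k <= mate be x)%N -> (k < N)%N -> c - 1 < kappa k.+1.
  move=> xk km kN; case: (ltngtP k.+1 x) => [|xk'|->]; first by rewrite ltnNge xk.
    move: km; rewrite leq_eqVlt => /predU1P[e|km].
      have [_ + _] := @kappa_mateS x (Ordinal kN) xs (esym e).
      by rewrite /= => ->; rewrite -/c; clear; lia.
    have := @kappa_mate x k.+1 xs; rewrite xk' km => /(_ isT); rewrite kx; clear; lia.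
  by rewrite -/c; clear; lia.
have at_k k : (x <= k.+1)%N -> (k <= mate be x)%N -> (k < N)%N ->
    exists a, [/\ a \in reg, a.1 = k :> nat & depth a = c - 1].
  move=> xk km kN.
  have [|a [ar u da]] := @region_box _ _ _ le (Ordinal kN) (c - 1).
    by rewrite c1 /=; exact: kap.
  by exists a; rewrite u.
have in' a : a \in reg -> depth a = c - 1 -> (x <= a.1.+1)%N -> (a.1 <= mate be x)%N ->
    a \in strip x'.
  have right n a' : a' \in strip x' -> depth a' = c - 1 -> (x <= a'.1.+1)%N ->
      forall a, a \in reg -> depth a = c - 1 -> (a.1 <= mate be x)%N ->
      a.1 = (a'.1 + n)%N :> nat -> a \in strip x'.
    move=> a'S da' xa'; elim: n => [|n IH] a1 ar da am ua.
      by rewrite (region_eq le ar (subr _ _ a'S)) ?da ?da' // ua addn0.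
    have [||| a2 [a2r ua2 da2]] := @at_k (a'.1 + n)%N.
    - by move: xa'; clear; lia.
    - by move: am; rewrite ua; clear; lia.
    - by have := ltn_ord a1.1; rewrite ua; clear; lia.
    apply: (strip_block xs' (IH _ a2r da2 _ ua2) ar _ _); rewrite ?da ?da2 //.
      by move: am; rewrite ua ua2; clear; lia.
    by left; rewrite ua ua2 addnS.
  have left n : forall a, a \in reg -> depth a = c - 1 -> (x <= a.1.+1)%N ->
      b'.1 = (a.1 + n)%N :> nat -> a \in strip x'.
    elim: n => [|n IH] a1 ar da xa ua.
      by rewrite (region_eq le ar b'r) ?da ?d' // ua addn0.
    have [||| a2 [a2r ua2 da2]] := @at_k a1.1.+1.
    - by move: xa; clear; lia.
    - by case/andP: xb' => _; rewrite ua; clear; lia.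
    - by have := ltn_ord b'.1; rewrite ua; clear; lia.
    apply: (strip_block xs' (IH _ a2r da2 _ _) ar _ _); rewrite ?da ?da2 //.
    - by rewrite ua2 (leq_trans xa).
    - by rewrite ua ua2 addSnnS.
    - by right.
  move=> ar da xa am; case: (leqP b'.1 a.1) => lt.
    apply: (right (a.1 - b'.1)%N b') => //; first by case/andP: xb'.
    by rewrite subnKC.
  by apply: (left (b'.1 - a.1)%N) => //; rewrite subnKC // ltnW.
apply/forallP => e; apply/implyP => eS.
have er := subr _ _ eS; have pe := pE _ er; rewrite (dx _ eS) in pe.
have xe : (x <= e.1 < mate be x)%N by have [] := strip_mem eS.
have ok a p : a \in strip x \/ a \in strip x' -> pos a = p ->
    [exists b' in strip x :|: strip x', pos b' == p].
  by move=> /orP aS ap; apply/existsP; exists a; rewrite inE aS ap eqxx.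
have posE a (u : nat) (y : int) : a \in reg -> a.1 = u :> nat ->
    height be u.+1 - 1 - 2 * depth a = y -> pos a = (u.+1%:Z, y).
  by move=> ar ua <-; rewrite [LHS]surjective_pairing pE // /= ua.
(* The box just above lies at depth [c - 1]. A side neighbour lies at depth [c - 1] or [c], hence in
   [strip x'] or in [strip x], according to the step of [be] between the columns. *)
apply/allP => p; rewrite !inE => /or3P[]/eqP->; apply/implyP => pN.
- have [||| a [ar ua da]] := @at_k e.1.
  + by move: xe; clear; lia.
  + by move: xe; clear; lia.
  + exact: ltn_ord.
  apply: (ok a); first by right; apply: in' => //; rewrite ua; move: xe; clear; lia.
  by rewrite (posE a e.1 ((pos e).2 + 2)) // da pe; clear; lia.
- case e0: (e.1 : nat) => [|k].
    exfalso; have x0 : x = 0%N :> nat by move: xe; rewrite e0; clear; lia.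
    by move: c1; rewrite /c x0 kappa0; clear; lia.
  have kN : (k < N)%N by have := ltn_ord e.1; rewrite e0; exact: ltnW.
  have hs := heightS be e.1; rewrite /step e0 in hs.
  have p1 : (pos e).1 - 1 = k.+1%:Z by rewrite /= e0; clear; lia.
  case be1: (be e.1) hs => hs.
    have [||| a [ar ua da]] := @at_k k => //.
    + by move: xe; rewrite e0; clear; lia.
    + by move: xe; rewrite e0; clear; lia.
    apply: (ok a).
      by right; apply: in' => //; rewrite ua; move: xe; rewrite e0; clear; lia.
    by rewrite (posE a k ((pos e).2 + 1)) // ?p1 // da pe e0 hs; clear; lia.
  have xk : (x <= k)%N.
    have : e.1 != x by apply/eqP => ex; rewrite ex bx in be1.
    by rewrite -(inj_eq val_inj) /= e0; move: xe; rewrite e0; clear; lia.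
  have [|a aS ua] := @strip_box x k xs; first by move: xe; rewrite e0 xk; clear; lia.
  apply: (ok a); first by left.
  rewrite (posE a k ((pos e).2 + 1)) ?p1 // ?(subr _ _ aS) // dx // pe e0 hs.
  by clear; lia.
- have kN : (e.1.+1 < N)%N by move: pN; rewrite /=; clear; lia.
  pose y := Ordinal kN.
  have hs := heightS be y; rewrite /step in hs.
  have p1 : (pos e).1 + 1 = e.1.+2%:Z by rewrite /=; clear; lia.
  case bey: (be y) hs => hs.
    have ym : (e.1.+1 < mate be x)%N.
      rewrite ltn_neqAle; case/andP: xe => _ ->; rewrite andbT; apply/eqP => ey.
      by have [_ _] := @kappa_mateS x y xs (esym ey); rewrite bey.
    have [|a aS ua] := @strip_box x e.1.+1 xs; first by move: xe; rewrite ym; clear; lia.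
    apply: (ok a); first by left.
    rewrite (posE a e.1.+1 ((pos e).2 + 1)) ?p1 // ?(subr _ _ aS) // dx // pe.
    by move: hs => /= ->; clear; lia.
  have [||| a [ar ua da]] := @at_k e.1.+1 => //.
  + by move: xe; clear; lia.
  + by case/andP: xe.
  apply: (ok a); first by right; apply: in' => //; rewrite ua; move: xe; clear; lia.
  rewrite (posE a e.1.+1 ((pos e).2 + 1)) ?p1 // da pe.
  by move: hs => /= ->; clear; lia.
Qed.

Lemma strips_conf : strips \in ConfII al be.
Proof.
rewrite inE strips_partition strips_rule0 strips_ruleIIa !andbT /=.
apply/forallP => D; apply/implyP => /imsetP[x xs ->].
by have [l [l' [-> _ _]]] := strip_lengthP xs.
Qed.

End Sufficient.

End Configurations.

(** * Comparison of the weights *)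

Section Weights.
Variables (L : comUnitRingType) (t tN : L).
Hypotheses (t_unit : t \is a GRing.unit) (tN_unit : tN \is a GRing.unit).
Variables (N : nat) (al be : word N).
Hypothesis le : leB al be.

Lemma strip_weight_pair x y : compatible al be -> x \in starts al be ->
  (x, y) \in (pairing be).1 -> strip_weight t tN (strip al be x) = t ^+ (y - x.+1).
Proof.
move=> comp xs qs; have [l [l' [sl xn hm]]] := strip_lengthP le comp xs.
rewrite /strip_weight sl; rewrite (mate_pair qs) in xn hm.
have l'0 : l' = 0%N :> nat.
  by move: hm; rewrite (height_pair xs qs); clear; lia.
by rewrite l'0 /= -xn; congr (_ ^+ _); rewrite l'0; clear; lia.
Qed.

(** The strip runs to the anchor column and rises by the number of unpaired 2's right of [x], so
    [l'] is the rank of [x] and odd [l'] is the e-case. *)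
Lemma strip_weight_unpaired x : compatible al be -> x \in starts al be ->
  x \in unpaired2_seq be -> strip_weight t tN (strip al be x) =
    t ^+ (N - x.+1) * (if odd (rank_from_right be x) then t^-1 * tN ^+ 2 else 1).
Proof.
move=> comp xs xu; have [l [l' [sl xn hm]]] := strip_lengthP le comp xs.
rewrite /strip_weight sl; rewrite (mate_unpaired xu) in xn hm.
have [bx _] := starts_letters xs.
have l'E : l' = rank_from_right be x :> nat.
  have := rank_height (b := be) (x := x); rewrite inE => /(_ xu).
  by rewrite hm heightS /step bx; clear; lia.
rewrite -l'E; have -> : (N - x.+1 = l.*2 + l')%N by move: xn; clear; lia.
case: ifP => odl; last by rewrite mulr1.
have [k ->] : exists k, (l.*2 + l' = k.+1)%N.
  by exists (l.*2 + l').-1; case: (l' : nat) odl => // k _; rewrite addnS.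
by rewrite subn1 /= [t ^+ k.+1]exprSr [RHS]mulrA mulrK.
Qed.

Definition position_weight (i : 'I_N) : L :=
  (if al i then t ^+ (N - i.+1) * tN else 1) / (if be i then t ^+ (N - i.+1) * tN else 1).

Lemma tpow_prod (a : word N) :
  tpow t tN a = \prod_i (if a i then t ^+ (N - i.+1) * tN else 1).
Proof.
rewrite /tpow -big_mkcond big_split /= expr_sum; congr (_ * _).
by rewrite prodr_const; congr (_ ^+ _); apply: eq_card => i; rewrite !inE.
Qed.

Lemma tdiff_prod : tdiff t tN al be = \prod_i position_weight i.
Proof.
rewrite /tdiff !tpow_prod -prodrV -?big_split //= => i _.
by case: (be i); rewrite ?unitr1 // unitrM unitrX.
Qed.

Lemma big_pairing (F : 'I_N -> L) :
  \prod_i F i = \prod_(q <- (pairing be).1) (F q.1 * F q.2) * \prod_(i <- (pairing be).2) F i.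
Proof.
rewrite -big_enum (perm_big _ (pairing_perm be)) big_cat big_flatten big_map /=.
by congr (_ * _); apply: eq_bigr => q _; rewrite big_cons big_seq1.
Qed.

(** A flipped pair [(x, y)] contributes t^-(y-x) against a strip of weight t^(y-x-1), leaving t^-1.
    A flipped unpaired 2 contributes t^-(N-x-1) tN^-1, and its strip leaves tN^-1 or tN/t. *)
Lemma tdiff_strips : compatible al be ->
  tdiff t tN al be * \prod_(x in starts al be) strip_weight t tN (strip al be x) =
  kl_coef t tN al be.
Proof.
move=> comp; have /andP[/allP cp /allP cr] := comp.
rewrite tdiff_prod [X in _ * X]big_mkcond -big_split big_pairing kl_coefE.
congr (_ * _); apply: eq_big_seq.
  move=> [x y] qs; have /= nxy := cp _ qs.
  have /andP[/= bx /negPf bNy] := pairing_letters qs.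
  have [/= xy _ _] := pair_height qs.
  rewrite /pair_weight (negPf nxy) /position_weight bx bNy [y \in _]inE bNy /= !divr1 mulr1.
  case: (boolP (x \in starts al be)) => [xs|]; last first.
    rewrite inE bx /=; case: (al x) nxy => //; case: (al y) => // _ _.
    by rewrite !mulr1 divrr // unitrM unitrX.
  have [_ ax] := starts_letters xs; move: nxy; rewrite (strip_weight_pair comp xs qs) ax.
  case: (al y) => // _; apply: (mulIr t_unit); rewrite mulVr // mul1r.
  have eN : (N - x.+1 = (y - x.+1) + (N - y.+1).+1)%N.
    by have := ltn_ord y; move: xy; clear; lia.
  rewrite -!mulrA mulrC; apply: (mulIr (_ : t ^+ (N - x.+1) * tN \is a GRing.unit)).
    by rewrite unitrM unitrX.
  rewrite mulrVK ?unitrM ?unitrX // mul1r eN exprD exprSr.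
  by rewrite -!mulrA; congr (_ * (_ * _)); rewrite mulrC.
move=> i ir; have := cr _ ir; rewrite /position_weight /rest_weight.
case: (boolP (i \in starts al be)) => [xs|]; last first.
  rewrite inE; case: (be i) (al i) => [] [] //= _ _; rewrite mulr1 divrr ?unitr1 //.
  by rewrite unitrM unitrX.
have [bi ai] := starts_letters xs; rewrite bi ai => _.
rewrite strip_weight_unpaired // ?mem_filter ?bi //.
rewrite /= mul1r mulrA invrM ?unitrX // mulrVK ?unitrX //.
rewrite /unpaired_weight; case: odd; last by rewrite mulr1.
by rewrite mulrCA expr2 mulKr // mulrC.
Qed.

Lemma QII_compatible : compatible al be ->
  tdiff t tN al be * QII t tN al be = kl_coef t tN al be.
Proof.
move=> comp; rewrite -tdiff_strips //; congr (_ * _).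
have -> : QII t tN al be = \sum_(Pi in [set strips al be]) \prod_(D in Pi) strip_weight t tN D.
  apply: eq_bigl => Pi; rewrite inE; apply/idP/eqP => [/(ConfII_configuration le) conf|->].
    exact: conf_eq conf.
  exact: strips_conf.
by rewrite big_set1 /strips big_imset //; exact: strip_inj.
Qed.

Lemma QII_kl_coef : tdiff t tN al be * QII t tN al be = kl_coef t tN al be.
Proof.
case: (boolP (compatible al be)) => [|ncomp]; first exact: QII_compatible.
rewrite (kl_coef_compatible t tN ncomp) /QII big_pred0 ?mulr0 // => Pi.
apply/negP => /(ConfII_configuration le) conf; case/negP: ncomp.
exact: conf_compatible conf.
Qed.

End Weights.

Theorem corollary16 (R : realType) (N : nat) (N_gt0 : (0 < N)%N)
  (* Case A: the ring of Laurent polynomials and its bar involution *)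
  (L : comUnitAlgType (R[i])%C) (t tN : L) (laurentL : is_laurent t tN)
  (barL : {lrmorphism L -> L}) (barL_t : barL t = t^-1)
  (barL_tN : barL tN = tN^-1)
  (* the Hecke algebra of type B_N and its bar involution *)
  (H : algType L) (T : 'I_N -> H) (heckeH : is_heckeB t tN T)
  (barH : {lrmorphism H -> H | barL \; *:%R})
  (barH_T : forall i, T i * barH (T i) = 1 /\ barH (T i) * T i = 1)
  (* the module M^-, its bar involution and the Kazhdan-Lusztig polynomials *)
  (M : lmodType H) (m : word N -> M) (minusM : is_Mminus t tN T m)
  (barM : {linear M -> M | barH \; *:%R})
  (barM_all1 : barM (m (all1 N)) = m (all1 N))
  (C : word N -> M) (P : word N -> word N -> L)
  (klP : is_KL t tN m barM C P)
  (al be : word N) :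
  leB al be ->
  tdiff t tN al be * QII t tN al be = tdiff t tN al be * P al be /\
  (al \in FA be ->
   tdiff t tN al be * P al be =
     t ^- dA al be * tN ^- dAo al be * (t / tN) ^- dAe al be).
Proof.
move=> le; have tu := t_unit laurentL; have tNu := tN_unit laurentL.
have PE := kl_coef_unique laurentL barL_t barL_tN (proj1 heckeH) barH_T minusM
  barM_all1 klP le.
split; first by rewrite PE; exact: QII_kl_coef.
by rewrite FA_compatible PE; exact: kl_coef_FA.
Qed.
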